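(* Let $d\ge 1$, let $(\mathbf X,\mathbf X')\in\mathbb H^d\times\mathbb H^d$ be a matrix Stein pair with conditional variance $\mathbf\Delta_{\mathbf X}$, and assume that $\mathbf X$ is almost surely bounded in norm. Define $$r(\psi)=\frac1\psi\log\mathbb E\,\bar{\mathrm{tr}}\,e^{\psi\mathbf\Delta_{\mathbf X}}\qquad\text{for each }\psi>0.$$ Then, for all $t\ge0$ and all $\psi>0$, $$\mathbb P\{\lambda_{\max}(\mathbf X)\ge t\}\le d\cdot\exp\Big\{\frac{-t^2}{2r(\psi)+2t/\sqrt\psi}\Big\}.$$ Furthermore, for all $\psi>0$, $$\mathbb E\,\lambda_{\max}(\mathbf X)\le\sqrt{2r(\psi)\log d}+\frac{\log d}{\sqrt\psi}.$$
   Context: $\mathbb H^d$ is the space of $d\times d$ complex Hermitian matrices; $\lambda_{\max}$ is the largest eigenvalue; $\|\cdot\|$ is the spectral norm; $\bar{\mathrm{tr}}\,\mathbf B=\frac1d\mathrm{tr}\,\mathbf B$ is the normalized trace; $e^{\mathbf A}$ is the matrix exponential. ''Almost surely bounded in norm'' means that there is a deterministic constant $R<\infty$ with $\|\mathbf X\|\le R$ almost surely. Exchangeable pair: random variables $Z,Z'$ taking values in a Polish space $\mathcal Z$ form an exchangeable pair if $(Z,Z')$ and $(Z',Z)$ have the same distribution. Matrix Stein pair: let $(Z,Z')$ be an exchangeable pair in a Polish space $\mathcal Z$, let $\mathbf\Psi:\mathcal Z\to\mathbb H^d$ be measurable, and set $\mathbf X=\mathbf\Psi(Z)$, $\mathbf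 X'=\mathbf\Psi(Z')$. The pair $(\mathbf X,\mathbf X')$ is a matrix Stein pair with scale factor $\alpha\in(0,1]$ if $\mathbb E[\mathbf X-\mathbf X'\mid Z]=\alpha\mathbf X$ almost surely; it is always assumed that $\mathbb E\|\mathbf X\|^2<\infty$. Conditional variance: $\mathbf\Delta_{\mathbf X}=\frac1{2\alpha}\mathbb E[(\mathbf X-\mathbf X')^2\mid Z]$ (any version). *)

(* Defs.v *)
From HB Require Import structures.
From mathcomp Require Import all_boot all_order all_algebra.
From mathcomp Require Import all_classical all_reals all_analysis.
From mathcomp Require Import complex.

Set Implicit Arguments.
Unset Strict Implicit.
Unset Printing Implicit Defensive.
Import Order.TTheory GRing.Theory Num.Theory numFieldNormedType.Exports.
Local Open Scope classical_set_scope.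
Local Open Scope ring_scope.
Local Open Scope complex_scope.

(* Stated over an arbitrary numFieldType because the library attaches the norm
   topology of matrices to that structure; used with K := R[i]. *)
Definition mexp {K : numFieldType} {d : nat} (A : 'M[K]_d) : 'M[K]_d :=
  limn (series (fun k => (k`!%:R)^-1 *: A ^+ k)).

Section matrices.
Context {R : realType} {d : nat}.
Implicit Types (A : 'M[R[i]]_d) (x : 'cV[R[i]]_d).

(* The eigenvalues of a Hermitian matrix are real; for 0 < d they form a
   nonempty finite set of reals, so that the supremum is a maximum. *)
Definition lambda_max A : R := sup [set l : R | eigenvalue A l%:C].

Definition l2norm x : R :=
  Num.sqrt (\sum_(k < d) (complex.Re (x k 0) ^+ 2 + complex.Im (x k 0) ^+ 2)).

(* Norm of A as an operator on the Hilbert space C^d. *)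
Definition spectral_norm A : R :=
  sup [set l2norm (A *m x) | x in [set x | l2norm x <= 1]].

Definition normalized_trace A : R[i] := d%:R^-1 * \tr A.

End matrices.

(* The measurable structure of the library requires the carrier to be pointed;
   a space in which a random variable takes values is never empty. *)
Notation borel T := (g_sigma_algebraType (@open T)).

Definition polish (R : realType) (T : topologicalType) : Prop :=
  (exists2 D : set T, countable D & dense D) /\
  exists dist : T -> T -> R,
    [/\ forall x y, dist x y = 0 <-> x = y,
        forall x y, dist x y = dist y x,
        forall x y z, dist x z <= dist x y + dist y z,
        forall x (A : set T), nbhs x A <->
          exists2 e : R, 0 < e & [set y | dist x y < e] `<=` A
      & forall u : nat -> T,
          (forall e : R, 0 < e -> exists N : nat, forall p q : nat,
            (N <= p)%N -> (N <= q)%N -> dist (u p) (u q) < e) ->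
          exists l : T, u @ \oo --> l].

Section random_matrices.
Context {R : realType} {disp : measure_display} {Omega : measurableType disp}.
Variable P : probability Omega R.
Context {S : ptopologicalType} {d : nat}.
Implicit Types (Z : Omega -> borel S) (F G V X Delta : Omega -> 'M[R[i]]_d).

(* Joint laws are compared on the product of the Borel sigma-algebras, which is
   the Borel sigma-algebra of S * S when S is Polish. *)
Definition exchangeable_pair Z Z' : Prop :=
  [/\ measurable_fun setT Z, measurable_fun setT Z'
    & forall A : set (borel S * borel S), measurable A ->
        pushforward P (fun w => (Z w, Z' w)) A =
        pushforward P (fun w => (Z' w, Z w)) A].

(* g is a version of E[f | Z]. *)
Definition is_condexp Z (f g : Omega -> R) : Prop :=
  [/\ P.-integrable setT (EFin \o f),
      measurable_fun setT (g : g_sigma_algebra_preimageType Z -> R),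
      P.-integrable setT (EFin \o g)
    & forall B : set (borel S), measurable B ->
        (\int[P]_(w in Z @^-1` B) (g w)%:E =
         \int[P]_(w in Z @^-1` B) (f w)%:E)%E].

Definition is_mx_condexp Z F G : Prop :=
  forall i j : 'I_d,
    is_condexp Z (fun w => complex.Re (F w i j)) (fun w => complex.Re (G w i j)) /\
    is_condexp Z (fun w => complex.Im (F w i j)) (fun w => complex.Im (G w i j)).

Definition mx_measurable (Psi : borel S -> 'M[R[i]]_d) : Prop :=
  forall i j : 'I_d,
    measurable_fun setT (fun z => complex.Re (Psi z i j)) /\
    measurable_fun setT (fun z => complex.Im (Psi z i j)).

Record matrix_stein_pair Z Z' (Psi : borel S -> 'M[R[i]]_d) (alpha : R) X X'
    : Prop := MatrixSteinPair {
  stein_exchangeable : exchangeable_pair Z Z' ;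
  stein_hermitian : forall z, Psi z \is hermsymmx ;
  stein_measurable : mx_measurable Psi ;
  stein_left : X = Psi \o Z ;
  stein_right : X' = Psi \o Z' ;
  stein_scale : 0 < alpha <= 1 ;
  stein_square_integrable :
    (\int[P]_w ((spectral_norm (X w)) ^+ 2)%:E < +oo)%E ;
  stein_condition : exists2 V, is_mx_condexp Z (fun w => X w - X' w) V
    & {ae P, forall w, V w = alpha%:C *: X w}
}.

(* Delta is a version of the conditional variance. *)
Definition is_conditional_variance Z (alpha : R) X X' Delta : Prop :=
  exists2 V, is_mx_condexp Z (fun w => (X w - X' w) ^+ 2) V
    & forall w, Delta w = ((2 * alpha)^-1)%:C *: V w.

Definition ae_bounded_in_norm X : Prop :=
  exists K : R, {ae P, forall w, spectral_norm (X w) <= K}.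

(* The normalized trace of exp (psi Delta) is almost surely real, since a
   version of the conditional variance is almost surely Hermitian. *)
Definition r_psi Delta (psi : R) : R :=
  psi^-1 * ln (fine 'E_P[fun w =>
    complex.Re (normalized_trace (mexp (psi%:C *: Delta w)))]).

End random_matrices.

(* Main.v *)
(* For Hermitian A and B, tr (f A * g B) is a combination of the numbers
   f (a_i) * g (b_j) over pairs of eigenvalues with nonnegative weights, so that
   an inequality between such traces follows from the scalar one.  Write m(s)
   for the expected normalized trace of e^{sX}.  Exchangeability and the mean
   value trace inequality give m'(s) <= s E tr (Delta e^{sX}).  Young's
   inequality bounds psi E tr (Delta e^{sX}) by psi r(psi) m(s) + s m'(s), as
   m >= 1.  Hence m' (1 - s^2 / psi) <= s r(psi) m, which integrates to
   ln m(s) <= r(psi) s^2 / (2 (1 - s / sqrt psi)) for 0 < s < sqrt psi, and both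
   bounds follow from the Laplace transform method.  The almost sure bound on X
   allows every random matrix to be replaced by a bounded version that agrees
   with it almost surely. *)
Require Import Defs.
From HB Require Import structures.
From mathcomp Require Import all_boot all_order all_algebra.
From mathcomp Require Import all_classical all_reals all_analysis.
From mathcomp Require Import complex.
From mathcomp Require Import measurable_realfun.
From mathcomp Require Import spectral.
From mathcomp Require Import ring lra.
Import Order.TTheory GRing.Theory Num.Theory numFieldNormedType.Exports.
Local Open Scope classical_set_scope.
Local Open Scope ring_scope.
Local Open Scope complex_scope.

Set Implicit Arguments.
Unset Strict Implicit.
Unset Printing Implicit Defensive.

(** * Functional calculus of Hermitian matrices *)

(** [X] and [X'] need not commute, nor [X] and [Delta]; but every trace to be bounded multiplies a
    function of one Hermitian matrix by a function of another, and this is all that the pairing of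
    two eigenbases can handle. The Stein condition gives alpha m'(s) = E tr ((X - X') e^{sX}), and
    exchanging X and X' turns this into half of E tr ((X - X') (e^{sX} - e^{sX'})), a difference to
    which the mean value inequality applies. Young's inequality returns a term s m'(s), which has to
    be absorbed on the left; this confines s to the interval below sqrt psi. To integrate up to s,
    the factor 1 - t^2 / psi is replaced for t < s by the smaller constant 1 - s / sqrt psi, so that
    a Gaussian integrating factor suffices. Versions of conditional expectations are Hermitian and
    bounded only outside a null set, whereas the spectral calculus needs Hermitian matrices at every
    point; hence they are symmetrized and truncated entry by entry before anything is
    exponentiated. *)

Section functional_calculus.
Context {R : realType} {d : nat}.
Implicit Types (A B : 'M[R[i]]_d) (f g : R -> R).

(** For Hermitian [A] the spectral diagonal is real, so taking real parts loses nothing and allows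
    functions from [R] to [R] to be applied. *)
Definition eigval A (i : 'I_d) : R := complex.Re (spectral_diag A 0 i).

(** This is f(A) when [A] is Hermitian. The algebraic rules below use only that [spectralmx A] is
    invertible and so hold for every [A]; [mxfun_id] is where Hermitian symmetry enters. *)
Definition mxfun f A : 'M[R[i]]_d :=
  invmx (spectralmx A) *m diag_mx (\row_j (f (eigval A j))%:C) *m spectralmx A.

Lemma mxfunM f g A : mxfun f A *m mxfun g A = mxfun (fun x => f x * g x) A.
Proof.
rewrite /mxfun !mulmxA; congr (_ *m _); rewrite -!mulmxA; congr (_ *m _).
rewrite mulKVmx ?spectral_unit// mulmx_diag; congr diag_mx.
by apply/rowP => j; rewrite !mxE rmorphM.
Qed.

Lemma mxfun1 A : mxfun (fun=> 1) A = 1%:M.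
Proof.
rewrite /mxfun (_ : \row__ _ = const_mx 1); last by apply/rowP => j; rewrite !mxE.
by rewrite diag_const_mx mulmx1 mulVmx ?spectral_unit.
Qed.

Lemma mxfun_id A : A \is hermsymmx -> mxfun id A = A.
Proof.
move=> hA; have /hermitian_normalmx/orthomx_spectralP e := hA.
rewrite /mxfun (_ : \row__ _ = spectral_diag A); first exact: esym.
apply/rowP => j; rewrite !mxE /eigval RRe_real//.
by have /mxOverP := hermitian_spectral_diag_real hA; apply.
Qed.

(** Entries are linear in the values of [f] on the spectrum, with coefficients independent of [f];
    scalar limits therefore pass to matrices. *)
Lemma mxfunE f A i j : mxfun f A i j =
  \sum_k (f (eigval A k))%:C * (invmx (spectralmx A) i k * spectralmx A k j).
Proof.
rewrite /mxfun mxE; apply: eq_bigr => k _.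
by rewrite mul_mx_diag !mxE mulrAC mulrC.
Qed.

Lemma mxfunZ c f A : mxfun (fun x => c * f x) A = c%:C *: mxfun f A.
Proof.
apply/matrixP => i j; rewrite mxfunE mxE mxfunE mulr_sumr.
by apply: eq_bigr => k _; rewrite rmorphM mulrA.
Qed.

Lemma mxfunX n A : mxfun (fun x => x ^+ n) A = mxfun id A ^+ n.
Proof.
elim: n => [|n ih]; first by rewrite expr0 (eq_fun (fun=> expr0 _)) mxfun1.
by rewrite exprS -ih -[RHS]/(_ *m _) mxfunM; congr mxfun; apply/funext => x;
  rewrite exprS.
Qed.

Lemma mxtrace_mxfun f A : \tr (mxfun f A) = (\sum_i f (eigval A i))%:C.
Proof.
rewrite /mxfun -mulmxA mxtrace_mulC -mulmxA mulmxV ?spectral_unit// mulmx1.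
by rewrite mxtrace_diag rmorph_sum; apply: eq_bigr => i _; rewrite mxE.
Qed.

(* The weights are |u_ij|^2 for the unitary change of basis u between the
   eigenbases of A and B. *)
Lemma mxtrace_mxfun2 A B : exists c : 'I_d -> 'I_d -> R,
  (forall i j, 0 <= c i j) /\
  forall f g, \tr (mxfun f A *m mxfun g B) =
    (\sum_i \sum_j c i j * (f (eigval A i) * g (eigval B j)))%:C.
Proof.
pose U := spectralmx A *m invmx (spectralmx B).
exists (fun i j => complex.Re (`|U i j| ^+ 2)); split=> [i j|f g].
  have : 0 <= `|U i j| ^+ 2 by rewrite exprn_ge0.
  by rewrite lecE => /andP[_].
have UV : spectralmx B *m invmx (spectralmx A) = map_mx Num.conj U^T.
  rewrite /U !invmx_unitary ?spectral_unitarymx//.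
  by rewrite trmx_mul map_mxM trmxCK.
rewrite /mxfun -!mulmxA mxtrace_mulC -!mulmxA UV.
rewrite [spectralmx A *m _]mulmxA -/U.
rewrite /mxtrace rmorph_sum; apply: eq_bigr => i _.
rewrite mul_diag_mx !mxE rmorph_sum mulr_sumr; apply: eq_bigr => j _.
transitivity (`|U i j| ^+ 2 * ((f (eigval A i))%:C * (g (eigval B j))%:C)).
  rewrite normCK mul_diag_mx [(\matrix_(_, _) _) j i]mxE [(\row__ _) 0 j]mxE.
  by rewrite [(U ^t*)%sesqui j i]mxE [U^T j i]mxE; ring.
by rewrite 2!rmorphM; congr (_ * _); apply: esym; apply: RRe_real;
  rewrite rpredX ?normr_real.
Qed.

End functional_calculus.

(** * The matrix exponential *)

Lemma mx_limn (K : numFieldType) m n (u : nat -> 'M[K]_(m, n)) (L : 'M[K]_(m, n)) :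
  (forall e, 0 < e -> \forall k \near \oo, forall i j, `|L i j - u k i j| < e) ->
  limn u = L.
Proof.
move=> uL; apply/cvg_lim; first exact: norm_hausdorff.
apply/cvg_ballP => e e0; apply: filterS (uL _ e0) => k uLk.
by split => // i j; rewrite -ball_normE; exact: uLk.
Qed.

Section matrix_exponential.
Context {R : realType} {d : nat}.
Implicit Types (A L : 'M[R[i]]_d) (z : R[i]).

Lemma Re_add z1 z2 : complex.Re (z1 + z2) = complex.Re z1 + complex.Re z2.
Proof. by case: z1 z2 => [a b] [a' b']. Qed.

Lemma Im_add z1 z2 : complex.Im (z1 + z2) = complex.Im z1 + complex.Im z2.
Proof. by case: z1 z2 => [a b] [a' b']. Qed.

Lemma Re_sum I (r : seq I) (F : I -> R[i]) :
  complex.Re (\sum_(k <- r) F k) = \sum_(k <- r) complex.Re (F k).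
Proof. by elim/big_ind2 : _ => // x1 x2 y1 y2 <- <-; rewrite Re_add. Qed.

Lemma Im_sum I (r : seq I) (F : I -> R[i]) :
  complex.Im (\sum_(k <- r) F k) = \sum_(k <- r) complex.Im (F k).
Proof. by elim/big_ind2 : _ => // x1 x2 y1 y2 <- <-; rewrite Im_add. Qed.

Lemma Re_mul z1 z2 : complex.Re (z1 * z2) =
  complex.Re z1 * complex.Re z2 - complex.Im z1 * complex.Im z2.
Proof. by case: z1 z2 => [a b] [a' b']. Qed.

Lemma Im_mul z1 z2 : complex.Im (z1 * z2) =
  complex.Re z1 * complex.Im z2 + complex.Im z1 * complex.Re z2.
Proof. by case: z1 z2 => [a b] [a' b']. Qed.

Lemma Re_scale (r : R) z : complex.Re (r%:C * z) = r * complex.Re z.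
Proof. by rewrite Re_mul /= mul0r subr0. Qed.

Lemma Im_scale (r : R) z : complex.Im (r%:C * z) = r * complex.Im z.
Proof. by rewrite Im_mul /= mul0r addr0. Qed.

Lemma normc_le_ReIm z : `|z| <= (`|complex.Re z| + `|complex.Im z|)%:C.
Proof.
rewrite normc_def lecR -[leRHS]ger0_norm ?addr_ge0// -sqrtr_sqr.
rewrite ler_wsqrtr// sqrrD !real_normK ?num_real// [leRHS]addrAC lerDl.
by rewrite mulrn_wge0 ?mulr_ge0.
Qed.

Lemma normc_ge_Im z : `|complex.Im z|%:C <= `|z|.
Proof. by rewrite normc_def lecR -sqrtr_sqr ler_wsqrtr// lerDr sqr_ge0. Qed.

Lemma mx_limn_ReIm (u : nat -> 'M[R[i]]_d) L :
  (forall i j, complex.Re (u n i j) @[n --> \oo] --> complex.Re (L i j)) ->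
  (forall i j, complex.Im (u n i j) @[n --> \oo] --> complex.Im (L i j)) ->
  limn (u : nat -> 'M[(R[i] : numFieldType)]_d) = L.
Proof.
move=> cRe cIm; apply: mx_limn => e e0.
(* A positive element of [R[i]] is real, so it can be halved in [R], one half for each of the two
   parts. *)
have [e1 e1_gt0 ee] : exists2 e1 : R, 0 < e1 & e = (e1 + e1)%:C.
  exists (complex.Re e / 2).
    by move: e0; rewrite ltcE => /andP[_ ?]; rewrite divr_gt0.
  by rewrite -splitr RRe_real// gtr0_real.
have nRe : \forall n \near \oo, forall i j,
    `|complex.Re (L i j) - complex.Re (u n i j)| < e1.
  by apply: filter_forall => i; apply: filter_forall => j;
    move/cvgrPdist_lt : (cRe i j); apply.
have nIm : \forall n \near \oo, forall i j,
    `|complex.Im (L i j) - complex.Im (u n i j)| < e1.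
  by apply: filter_forall => i; apply: filter_forall => j;
    move/cvgrPdist_lt : (cIm i j); apply.
apply: filterS2 nRe nIm => n hRe hIm i j.
apply: le_lt_trans (normc_le_ReIm _) _; rewrite ee ltcR.
have Re_sub z1 z2 : complex.Re (z1 - z2) = complex.Re z1 - complex.Re z2.
  by case: z1 z2 => [a b] [a' b'].
have Im_sub z1 z2 : complex.Im (z1 - z2) = complex.Im z1 - complex.Im z2.
  by case: z1 z2 => [a b] [a' b'].
by rewrite Re_sub Im_sub ltrD.
Qed.

(** An entrywise norm is enough to dominate all powers, and its measurability is immediate. *)
Definition mxl1 A : R :=
  \sum_i \sum_j (`|complex.Re (A i j)| + `|complex.Im (A i j)|).

Lemma mxl1_ge0 A : 0 <= mxl1 A.
Proof. by rewrite !sumr_ge0// => i _; rewrite sumr_ge0// => j _;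
  rewrite addr_ge0. Qed.

Lemma normc_mxX A k i j : `|(A ^+ k) i j| <= (mxl1 A ^+ k)%:C.
Proof.
elim: k i j => [|k ih] i j.
  by rewrite !expr0 mxE; case: eqVneq => _; rewrite ?normr1 ?normr0 ?ler01.
rewrite !exprS mxE (le_trans (ler_norm_sum _ _ _))//.
rewrite rmorphM (@le_trans _ _
  ((\sum_l (`|complex.Re (A i l)| + `|complex.Im (A i l)|))%:C *
   (mxl1 A ^+ k)%:C))//.
  rewrite rmorph_sum mulr_suml ler_sum// => l _; rewrite normrM ler_pM//.
  exact: normc_le_ReIm.
rewrite ler_wpM2r ?ler0c ?exprn_ge0 ?mxl1_ge0//
  lecR /mxl1 [leRHS](bigD1 i)//= lerDl.
by rewrite sumr_ge0// => l _; rewrite sumr_ge0// => m _; rewrite addr_ge0.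
Qed.

Lemma exprZmx (c : R[i]) A k : (c *: A) ^+ k = c ^+ k *: A ^+ k.
Proof.
elim: k => [|k ih]; first by rewrite !expr0 scale1r.
by rewrite !exprS ih -[LHS]/(_ *m _) -scalemxAl -scalemxAr scalerA.
Qed.

Lemma invr_factC k : (k`!%:R^-1 : R[i]) = (k`!%:R^-1 : R)%:C.
Proof. by rewrite fmorphV rmorph_nat. Qed.

Section entry.
(** [p] is the real or the imaginary part; real linearity and |p z| <= |z| are all that absolute
    convergence needs. *)
Variable p : R[i] -> R.
Hypothesis p_add : forall z1 z2, p (z1 + z2) = p z1 + p z2.
Hypothesis p_scale : forall (r : R) z, p (r%:C * z) = r * p z.
Hypothesis p_norm : forall z, `|p z|%:C <= `|z|.

Let p0 : p 0 = 0.
Proof. by have := p_scale 0 0; rewrite mulr0 mul0r. Qed.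

Lemma mexp_term_le A k i j :
  `|p (((k`!%:R)^-1 *: A ^+ k) i j)| <= exp_coeff (mxl1 A) k.
Proof.
rewrite mxE invr_factC p_scale normrM ger0_norm ?invr_ge0//.
rewrite /exp_coeff /= mulrC ler_wpM2r ?invr_ge0//.
by rewrite -lecR (le_trans (p_norm _))// normc_mxX.
Qed.

Lemma mexp_entry_seriesE A i j n :
  p (series (fun k => (k`!%:R)^-1 *: A ^+ k) n i j) =
  series (fun k => p (((k`!%:R)^-1 *: A ^+ k) i j)) n.
Proof.
rewrite /series /= summxE; elim/big_ind2 : _ => // x1 x2 y1 y2 <- <-.
by rewrite p_add.
Qed.

Lemma mexp_entry_cvg A i j :
  cvgn (series (fun k => p (((k`!%:R)^-1 *: A ^+ k) i j))).
Proof.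
apply: normed_cvg; apply: series_le_cvg (is_cvg_series_exp_coeff (mxl1 A)) => //.
- by move=> n; exact: normr_ge0.
- by move=> n; rewrite exp_coeff_ge0// mxl1_ge0.
- by move=> n; exact: mexp_term_le.
Qed.

Lemma mexp_entry_lim_le A i j :
  `|limn (series (fun k => p (((k`!%:R)^-1 *: A ^+ k) i j)))| <= expR (mxl1 A).
Proof.
have cn : cvgn [normed series (fun k => p (((k`!%:R)^-1 *: A ^+ k) i j))].
  apply: series_le_cvg (is_cvg_series_exp_coeff (mxl1 A)) => //.
  - by move=> n; exact: normr_ge0.
  - by move=> n; rewrite exp_coeff_ge0// mxl1_ge0.
  - by move=> n; exact: mexp_term_le.
apply: le_trans (lim_series_norm cn) _.
apply: lim_series_le cn (is_cvg_series_exp_coeff (mxl1 A)) _ => n.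
exact: mexp_term_le.
Qed.

End entry.

(** The entrywise series are dominated by the real exponential series at [mxl1 A], so the limit in
    [mexp] is genuine and not a default value. *)
Lemma mexp_limE A : mexp A = \matrix_(i, j)
  (limn (series (fun k => complex.Re (((k`!%:R)^-1 *: A ^+ k) i j))) +i*
   limn (series (fun k => complex.Im (((k`!%:R)^-1 *: A ^+ k) i j)))).
Proof.
apply: mx_limn_ReIm => i j; rewrite mxE /=.
  under eq_fun do rewrite (mexp_entry_seriesE Re_add Re_scale).
  exact: (mexp_entry_cvg Re_scale (@normc_ge_Re _)).
under eq_fun do rewrite (mexp_entry_seriesE Im_add Im_scale).
exact: (mexp_entry_cvg Im_scale normc_ge_Im).
Qed.

Lemma Re_mexp_cvg A i j :
  series (fun k => complex.Re (((k`!%:R)^-1 *: A ^+ k) i j)) @ \oo -->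
  complex.Re (mexp A i j).
Proof. by rewrite mexp_limE mxE;
  exact: (mexp_entry_cvg Re_scale (@normc_ge_Re _)). Qed.

Lemma Im_mexp_cvg A i j :
  series (fun k => complex.Im (((k`!%:R)^-1 *: A ^+ k) i j)) @ \oo -->
  complex.Im (mexp A i j).
Proof. by rewrite mexp_limE mxE; exact: (mexp_entry_cvg Im_scale normc_ge_Im). Qed.

Lemma Re_mexp_le A i j : `|complex.Re (mexp A i j)| <= expR (mxl1 A).
Proof. by rewrite mexp_limE mxE;
  exact: (mexp_entry_lim_le Re_scale (@normc_ge_Re _)). Qed.

Lemma Im_mexp_le A i j : `|complex.Im (mexp A i j)| <= expR (mxl1 A).
Proof. by rewrite mexp_limE mxE;
  exact: (mexp_entry_lim_le Im_scale normc_ge_Im). Qed.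

Lemma mexp_mxfun A (s : R) : A \is hermsymmx ->
  mexp (s%:C *: A) = mxfun (fun x => expR (s * x)) A.
Proof.
move=> hA; rewrite -{1}(mxfun_id hA).
(* The calculus commutes with polynomials, so a partial sum of the matrix series is the calculus
   applied to a scalar partial sum. *)
have E n : series (fun k => (k`!%:R)^-1 *: (s%:C *: mxfun id A) ^+ k) n =
    mxfun (fun x => series (exp_coeff (s * x)) n) A.
  apply/matrixP => i j; rewrite mxfunE /series/= summxE.
  under [LHS]eq_bigr => k _.
    rewrite exprZmx -mxfunX scalerA -rmorphXn invr_factC -rmorphM -mxfunZ mxfunE.
    over.
  rewrite /=.
  rewrite exchange_big/=; apply: eq_bigr => k _.
  rewrite -mulr_suml; congr (_ * _); rewrite rmorph_sum; apply: eq_bigr => l _.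
  by rewrite /exp_coeff/= exprMn; congr (_%:C); ring.
apply: mx_limn_ReIm => i j.
  under eq_fun do rewrite E mxfunE Re_sum; rewrite mxfunE Re_sum.
  apply: cvg_big => [|k _]; first exact: add_continuous.
  under eq_fun do rewrite Re_scale; rewrite Re_scale.
  by apply: cvgMl; exact: is_cvg_series_exp_coeff.
under eq_fun do rewrite E mxfunE Im_sum; rewrite mxfunE Im_sum.
apply: cvg_big => [|k _]; first exact: add_continuous.
under eq_fun do rewrite Im_scale; rewrite Im_scale.
by apply: cvgMl; exact: is_cvg_series_exp_coeff.
Qed.

End matrix_exponential.

(** * Eigenvalues, [lambda_max] and normalized traces *)

Section eigenvalues.
Context {R : realType} {d : nat}.
Implicit Types A : 'M[R[i]]_d.

Lemma eigenvalue_eigval A i : A \is hermsymmx -> eigenvalue A (eigval A i)%:C.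
Proof.
(* Eigenvectors are row vectors here, namely the rows of [spectralmx A]; a zero row would make its
   determinant vanish. *)
move=> hA; apply/eigenvalueP; exists (row i (spectralmx A)).
  rewrite -row_mul -{2}(mxfun_id hA) /mxfun 2!mulmxA mulmxV ?spectral_unit// mul1mx.
  by apply/rowP => j; rewrite mxE mul_diag_mx 4!mxE.
apply: contraTneq (spectral_unit A) => r0; rewrite unitmxE (expand_det_row _ i).
rewrite big1 ?unitr0// => j _.
by have /rowP/(_ j) := r0; rewrite !mxE => ->; rewrite mul0r.
Qed.

Lemma eigenvalue_is_eigval A l : A \is hermsymmx -> eigenvalue A l%:C ->
  exists i, l = eigval A i.
Proof.
(* [w] holds the coordinates of the eigenvector in the eigenbasis; any nonzero coordinate identifies
   the eigenvalue. *)
move=> hA /eigenvalueP[v vA v0]; pose w := v *m invmx (spectralmx A).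
have wK : w *m spectralmx A = v by rewrite mulmxKV ?spectral_unit.
have wD : w *m diag_mx (\row_j (eigval A j)%:C) = l%:C *: w.
  rewrite /w scalemxAl -vA -{3}(mxfun_id hA) /mxfun.
  by rewrite 2!mulmxA mulmxK ?spectral_unit.
have [j wj] : exists j, w 0 j != 0.
  apply/existsP; apply: contraNT v0 => /existsPn w0; rewrite -wK.
  suff -> : w = 0 by rewrite mul0mx.
  by apply/rowP => j; rewrite [RHS]mxE; apply/eqP; rewrite -[_ == _]negbK.
exists j; have /rowP/(_ j) := wD.
rewrite mul_mx_diag mxE [in RHS]mxE mulrC [X in X * _ = _]mxE.
by move=> /(mulIf wj)[].
Qed.

Lemma eigval_le_lambda_max A i : A \is hermsymmx -> eigval A i <= lambda_max A.
Proof.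
move=> hA; apply: sup_ubound; last exact: eigenvalue_eigval.
exists (\sum_j `|eigval A j|) => l /= /(eigenvalue_is_eigval hA)[j ->].
by rewrite (bigD1 j)//= (le_trans (ler_norm _))// lerDl sumr_ge0.
Qed.

Lemma lambda_max_eigval A : (0 < d)%N -> A \is hermsymmx ->
  exists i, lambda_max A = eigval A i.
Proof.
move=> d0 hA; pose i := [arg max_(i > Ordinal d0) eigval A i]%O.
exists i; apply/eqP; rewrite eq_le eigval_le_lambda_max// andbT.
apply: ge_sup; first by exists (eigval A i); exact: eigenvalue_eigval.
move=> l /= /(eigenvalue_is_eigval hA)[j ->]; rewrite /i.
by case: arg_maxP => // k _; apply.
Qed.

Definition ntr A : R := complex.Re (normalized_trace A).

Lemma ntrE A : ntr A = d%:R^-1 * complex.Re (\tr A).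
Proof. by rewrite /ntr /normalized_trace -Re_scale fmorphV rmorph_nat. Qed.

Lemma ntrD A B : ntr (A + B) = ntr A + ntr B.
Proof. by rewrite !ntrE mxtraceD Re_add mulrDr. Qed.

Lemma ntrZ (r : R) A : ntr (r%:C *: A) = r * ntr A.
Proof. by rewrite !ntrE mxtraceZ Re_scale mulrCA. Qed.

Lemma ntrN A : ntr (- A) = - ntr A.
Proof. by rewrite !ntrE raddfN/=; case: (\tr A) => a b /=; rewrite mulrN. Qed.

Lemma ntrB A B : ntr (A - B) = ntr A - ntr B.
Proof. by rewrite ntrD ntrN. Qed.

Lemma ntr_mulC A B : ntr (A *m B) = ntr (B *m A).
Proof. by rewrite !ntrE mxtrace_mulC. Qed.

Lemma ntr1 : (0 < d)%N -> ntr 1%:M = 1.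
Proof.
move=> d0; rewrite ntrE mxtrace1 -(rmorph_nat (real_complex R)) /=.
by rewrite mulVf// pnatr_eq0 -lt0n.
Qed.

Lemma ntr_mxfun f A : ntr (mxfun f A) = d%:R^-1 * \sum_i f (eigval A i).
Proof. by rewrite ntrE mxtrace_mxfun. Qed.

(** The trace is a sum of positive terms, one of which is e^{s lambda_max}. The dimension factor of
    both final bounds originates here. *)
Lemma expR_lambda_max_le A (s : R) : (0 < d)%N -> A \is hermsymmx ->
  expR (s * lambda_max A) <= d%:R * ntr (mexp (s%:C *: A)).
Proof.
move=> d0 hA; rewrite mexp_mxfun// ntr_mxfun mulVKf ?pnatr_eq0 -?lt0n//.
have [i ->] := lambda_max_eigval d0 hA.
by rewrite (bigD1 i)//= lerDl sumr_ge0// => j _; rewrite expR_ge0.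
Qed.

Lemma ntr_mexp_le_lambda_max A (s : R) : (0 < d)%N -> 0 <= s -> A \is hermsymmx ->
  ntr (mexp (s%:C *: A)) <= expR (s * lambda_max A).
Proof.
move=> d0 s0 hA; rewrite mexp_mxfun// ntr_mxfun.
rewrite ler_pdivrMl ?ltr0n// mulr_natl -[X in _ *+ X](card_ord d) -sumr_const.
apply: ler_sum => i _.
by rewrite ler_expR ler_wpM2l// eigval_le_lambda_max.
Qed.

(** From a_i^2 <= tr A^2, whose d diagonal entries are at most [mxl1 A ^+ 2]. The constant is crude,
    as only boundedness matters. *)
Lemma eigval_le_mxl1 A i : A \is hermsymmx -> `|eigval A i| <= d%:R * mxl1 A.
Proof.
move=> hA; rewrite -(@ler_pXn2r _ 2%N) ?nnegrE ?mulr_ge0 ?mxl1_ge0//.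
rewrite real_normK ?num_real//.
apply: (@le_trans _ _ (\sum_j eigval A j ^+ 2)).
  by rewrite (bigD1 i)//= lerDl sumr_ge0// => j _; rewrite sqr_ge0.
have : complex.Re (\tr (A ^+ 2)) = \sum_j eigval A j ^+ 2.
  by rewrite -{1}(mxfun_id hA) -mxfunX mxtrace_mxfun.
move=> <-; apply: (@le_trans _ _ (d%:R * mxl1 A ^+ 2)).
  rewrite -[X in X%:R * _]card_ord mulr_natl -sumr_const /mxtrace Re_sum.
  apply: ler_sum => j _; rewrite (le_trans (ler_norm _))// -lecR.
  by rewrite (le_trans (normc_ge_Re _))// normc_mxX.
rewrite exprMn ler_wpM2r ?sqr_ge0//; case: (d) => [|n]; rewrite ?expr0n//.
by rewrite expr2 ler_peMl// ler1n.
Qed.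

(** A list item (k, (f, g)) encodes the term k f(x) g(y). The weights of [mxtrace_mxfun2] do not
    depend on f and g, so one choice serves all items and the scalar inequality is averaged over
    pairs of eigenvalues. *)
Lemma trace_ineq A B (s : seq (R * ((R -> R) * (R -> R)))) :
  (forall x y, 0 <= \sum_(p <- s) p.1 * (p.2.1 x * p.2.2 y)) ->
  0 <= \sum_(p <- s) p.1 * ntr (mxfun p.2.1 A *m mxfun p.2.2 B).
Proof.
move=> s_ge0; have [c [c0 cE]] := mxtrace_mxfun2 A B.
have -> : \sum_(p <- s) p.1 * ntr (mxfun p.2.1 A *m mxfun p.2.2 B) =
    d%:R^-1 * \sum_i \sum_j c i j *
      \sum_(p <- s) p.1 * (p.2.1 (eigval A i) * p.2.2 (eigval B j)).
  under eq_bigr do rewrite ntrE cE /= mulrCA.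
  rewrite -mulr_sumr; congr (_ * _).
  under eq_bigr do rewrite mulr_sumr.
  rewrite exchange_big; apply: eq_bigr => i _.
  under eq_bigr do rewrite mulr_sumr.
  rewrite exchange_big; apply: eq_bigr => j _.
  by rewrite mulr_sumr; apply: eq_bigr => p _; ring.
rewrite mulr_ge0// sumr_ge0// => i _; rewrite sumr_ge0// => j _.
by rewrite mulr_ge0.
Qed.

End eigenvalues.

(** * Scalar inequalities for the exponential *)

Section scalar_inequalities.
Context {R : realType}.
Implicit Types x y : R.

(** The trapezoid rule overestimates the integral of the convex function exp over [0, x]. The
    difference [h] vanishes at 0, and its derivative is nonnegative because (1 - z) e^z <= 1. *)
Lemma expR_trapezoid x : 0 <= x -> expR x - 1 <= x / 2 * (expR x + 1).
Proof.
pose h (y : R) := y / 2 * (expR y + 1) - (expR y - 1).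
have dh (y : R) : is_derive y 1 h ((1 - expR y + y * expR y) / 2).
  by rewrite /h; apply: is_derive_eq; rewrite /GRing.scale/=; field.
move=> x0; rewrite -subr_ge0 -/(h x).
have h0 : h 0 = 0 by rewrite /h expR0; ring.
rewrite -h0.
apply: (@ger0_derive1_le_cc _ h 0 x) => //; rewrite ?in_itv/= ?lexx ?x0//.
- move=> z _; rewrite derive1E derive_val divr_ge0//.
  have := expR_ge1Dx (- z); rewrite expRN => h1.
  have e0 := expR_gt0 z.
  have : (1 - z) * expR z <= 1 by rewrite -ler_pdivlMr// div1r.
  lra.
- apply: continuous_subspaceT => y.
  by apply/differentiable_continuous/derivable1_diffP.
Qed.

(** Both sides are symmetric in [x] and [y]; for y <= x, factoring out (x - y) e^{sy} leaves the
    trapezoid bound at s (x - y). *)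
Lemma expR_mean_value (s x y : R) : 0 <= s ->
  (x - y) * (expR (s * x) - expR (s * y)) <=
  s / 2 * ((x - y) ^+ 2 * (expR (s * x) + expR (s * y))).
Proof.
move=> s0; wlog xy : x y / y <= x.
  move=> H; have [/H//|/ltW/H] := leP y x.
  by rewrite -[X in X <= _ -> _]mulrNN !opprB -[(y - x) ^+ 2]sqrrN opprB [expR (s * y) + _]addrC.
have -> : expR (s * x) = expR (s * (x - y)) * expR (s * y).
  by rewrite -expRD; congr expR; ring.
have xy0 : 0 <= x - y by rewrite subr_ge0.
have h := expR_trapezoid (mulr_ge0 s0 xy0).
have -> : s / 2 * ((x - y) ^+ 2 * (expR (s * (x - y)) * expR (s * y) + expR (s * y)))
  = (x - y) * expR (s * y) * (s * (x - y) / 2 * (expR (s * (x - y)) + 1)) by field.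
have -> : (x - y) * (expR (s * (x - y)) * expR (s * y) - expR (s * y))
  = (x - y) * expR (s * y) * (expR (s * (x - y)) - 1) by ring.
by rewrite ler_wpM2l// mulr_ge0 ?expR_ge0// subr_ge0.
Qed.

End scalar_inequalities.

Lemma Re_normalized_trace {R : realType} {d} (A : 'M[R[i]]_d) :
  complex.Re (normalized_trace A) = ntr A.
Proof. by []. Qed.

(* Keeps unification from unfolding matrix products when it compares traces. *)
Opaque mxfun ntr.

(** * Trace inequalities *)

Section trace_inequalities.
Context {R : realType} {d : nat}.
Implicit Types A B X D : 'M[R[i]]_d.

Lemma mxfun_idl A f : A \is hermsymmx ->
  A *m mxfun f A = mxfun (fun x => x * f x) A.
Proof. by move=> hA; rewrite -{1}(mxfun_id hA) mxfunM. Qed.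

Lemma mxfun_idr A f : A \is hermsymmx ->
  mxfun f A *m A = mxfun (fun x => f x * x) A.
Proof. by move=> hA; rewrite -{2}(mxfun_id hA) mxfunM. Qed.

Lemma mxfun_comm A f : A \is hermsymmx -> mxfun f A *m A = A *m mxfun f A.
Proof.
move=> hA; rewrite (mxfun_idl f hA) (mxfun_idr f hA).
by under eq_fun do rewrite mulrC.
Qed.

Lemma ntr_mulBB A B E F : ntr ((A - B) *m (E - F)) =
  ntr (A *m E) - ntr (A *m F) - ntr (B *m E) + ntr (B *m F).
Proof.
by rewrite mulmxBl ntrB (mulmxBr A) (mulmxBr B) 2!ntrB opprB addrA addrAC.
Qed.

Lemma ntr_sqrB A B E : ntr ((A - B) ^+ 2 *m E) =
  ntr (A *m (A *m E)) - ntr (A *m (B *m E)) - ntr (B *m (A *m E)) +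
  ntr (B *m (B *m E)).
Proof.
rewrite expr2 -[(A - B) * (A - B)]/((A - B) *m (A - B)).
by rewrite -mulmxA (mulmxBl A B E) ntr_mulBB.
Qed.

(* Makes a function a variable, so that unification does not unfold it. *)
Lemma abstracted T (x : T) : exists y, y = x.
Proof. by exists x. Qed.

(** Commutation and cyclicity of the trace bring every word into the form of a function of [A] times
    a function of [B]. Order and nesting of the right-hand side, with its final 0, are those of the
    sum over the list in [ntr_mexp_mean_value]. *)
Lemma ntr_mean_value_expand A B E F (s : R) :
  E *m A = A *m E -> F *m B = B *m F ->
  s / 2 * ntr ((A - B) ^+ 2 *m (E + F)) - ntr ((A - B) *m (E - F)) =
  s / 2 * ntr (A *m (A *m E)) + (s / 2 * ntr (E *m (B *m B)) +
  (- s * ntr (A *m E *m B) + (s / 2 * ntr (A *m A *m F) +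
  (s / 2 * ntr (B *m (B *m F)) + (- s * ntr (A *m (B *m F)) +
  (-1 * ntr (A *m E) + (1 * ntr (A *m F) + (1 * ntr (E *m B) +
  (-1 * ntr (B *m F) + 0))))))))).
Proof.
move=> cE cF.
rewrite (mulmxDr _ E F).
rewrite (ntrD (_ *m E)).
rewrite (ntr_sqrB A B E).
rewrite (ntr_sqrB A B F).
rewrite ntr_mulBB.
have -> : ntr (A *m (B *m E)) = ntr (A *m E *m B).
  by rewrite (ntr_mulC A (B *m E)) -(mulmxA B) cE (ntr_mulC B).
have -> : ntr (B *m (A *m E)) = ntr (A *m E *m B) by rewrite (ntr_mulC B).
have -> : ntr (B *m (B *m E)) = ntr (E *m (B *m B)).
  by rewrite mulmxA (ntr_mulC _ E).
have -> : ntr (B *m (A *m F)) = ntr (A *m (B *m F)).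
  by rewrite (ntr_mulC B) -(mulmxA A F) cF.
have -> : ntr (A *m (A *m F)) = ntr (A *m A *m F) by rewrite mulmxA.
have -> : ntr (B *m E) = ntr (E *m B) by rewrite (ntr_mulC B).
move: (ntr _) (ntr _) (ntr _) (ntr _) (ntr _) (ntr _) (ntr _) (ntr _) (ntr _) (ntr _).
by move=> n1 n2 n3 n4 n5 n6 n7 n8 n9 n10; field.
Qed.

Lemma mxfun_sqr A : A \is hermsymmx -> mxfun (fun x => x * x) A = A *m A.
Proof. by move=> hA; rewrite -(mxfunM id id) mxfun_id. Qed.

(* By the eigenbasis pairing this reduces to the trapezoid bound for exp:
   (x - y) (e^{sx} - e^{sy}) <= s/2 (x - y)^2 (e^{sx} + e^{sy}). *)
Lemma ntr_mexp_mean_value A B (s : R) : 0 <= s ->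
    A \is hermsymmx -> B \is hermsymmx ->
  ntr ((A - B) *m (mexp (s%:C *: A) - mexp (s%:C *: B))) <=
  s / 2 * ntr ((A - B) ^+ 2 *m (mexp (s%:C *: A) + mexp (s%:C *: B))).
Proof.
move=> s0 hA hB; rewrite !mexp_mxfun//.
have [e eE] := abstracted (fun x => expR (s * x)).
have [xe xeE] := abstracted (fun x => x * e x).
have [xxe xxeE] := abstracted (fun x => x * xe x).
have [sq sqE] := abstracted (fun x : R => x * x).
have [one oneE] := abstracted (fun _ : R => 1 : R).
have [idf idE] := abstracted (@id R).
(* The ten products in s/2 (x - y)^2 (e x + e y) - (x - y) (e x - e y), the factor in x first. *)
have := @trace_ineq _ _ A B
  [:: (s / 2, (xxe, one)); (s / 2, (e, sq)); (- s, (xe, idf)); (s / 2, (sq, e));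
      (s / 2, (one, xxe)); (- s, (idf, xe)); (- 1, (xe, one)); (1, (idf, e));
      (1, (e, idf)); (- 1, (one, xe))].
rewrite unlock /= => /(_ _)/wrap[x y|].
  have := expR_mean_value x y s0; rewrite xxeE sqE xeE oneE idE eE -subr_ge0.
  by congr (0 <= _); field.
have xeA : mxfun xe A = A *m mxfun e A by rewrite xeE (mxfun_idl e hA).
have xeB : mxfun xe B = B *m mxfun e B by rewrite xeE (mxfun_idl e hB).
have -> : mxfun xxe A = A *m (A *m mxfun e A)
  by rewrite xxeE -(mxfun_idl xe hA) xeA.
have -> : mxfun xxe B = B *m (B *m mxfun e B)
  by rewrite xxeE -(mxfun_idl xe hB) xeB.
rewrite xeA xeB.
have -> : mxfun sq A = A *m A by rewrite sqE (mxfun_sqr hA).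
have -> : mxfun sq B = B *m B by rewrite sqE (mxfun_sqr hB).
have -> : mxfun idf A = A by rewrite idE (mxfun_id hA).
have -> : mxfun idf B = B by rewrite idE (mxfun_id hB).
have -> : mxfun one A = 1%:M by rewrite oneE mxfun1.
have -> : mxfun one B = 1%:M by rewrite oneE mxfun1.
rewrite -eE; have := ntr_mean_value_expand s (mxfun_comm e hA) (mxfun_comm e hB).
move: (mxfun e A) (mxfun e B) => E F e1.
rewrite (mulmx1 (A *m (A *m E))) (mulmx1 (A *m E)).
rewrite (mul1mx (B *m (B *m F))) (mul1mx (B *m F)) => h.
rewrite -subr_ge0 e1.
exact: h.
Qed.

(* Young's inequality: e^v >= e^h + (v - h) e^h with v = psi D - c and
   h = s X - l; with c and l the logarithms of the moment generating functions
   it bounds E tr(D e^{sX}) by an entropy. *)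
Lemma ntr_young X D (psi s c l : R) : X \is hermsymmx -> D \is hermsymmx ->
  expR (- l) * (psi * ntr (D *m mexp (s%:C *: X)) +
    (l - c + 1) * ntr (mexp (s%:C *: X)) - s * ntr (X *m mexp (s%:C *: X))) <=
  expR (- c) * ntr (mexp (psi%:C *: D)).
Proof.
move=> hX hD; rewrite !mexp_mxfun//.
have [e eE] := abstracted (fun x => expR (s * x)).
have [g gE] := abstracted (fun x => expR (psi * x)).
have [xe xeE] := abstracted (fun x => x * e x).
have [one oneE] := abstracted (fun _ : R => 1 : R).
have [idf idE] := abstracted (@id R).
have := @trace_ineq _ _ X D
  [:: (expR (- c), (one, g)); (- (expR (- l) * psi), (e, idf));
      (- (expR (- l) * (l - c + 1)), (e, one)); (expR (- l) * s, (xe, one))].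
rewrite unlock /= => /(_ _)/wrap[x y|].
  (* The scalar form is 1 + z <= e^z at z = (psi y - c) - (s x - l), multiplied by e^{s x - l}. *)
  have := expR_ge1Dx ((psi * y - c) - (s * x - l)).
  rewrite -(ler_pM2l (expR_gt0 (s * x - l))) -expRD subrKC [psi * y - c]addrC.
  rewrite [s * x - l]addrC 2!expRD xeE oneE idE eE gE -subr_ge0 => h.
  apply: le_trans h _; rewrite le_eqVlt; apply/orP; left.
  by apply/eqP; ring.
have -> : mxfun xe X = X *m mxfun e X by rewrite xeE (mxfun_idl e hX).
have -> : mxfun idf D = D by rewrite idE (mxfun_id hD).
have -> : mxfun one X = 1%:M by rewrite oneE mxfun1.
have -> : mxfun one D = 1%:M by rewrite oneE mxfun1.
rewrite -eE -gE; move: (mxfun e X) (mxfun g D) => E G.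
rewrite (mul1mx G) (mulmx1 E) (mulmx1 (X *m E)) (ntr_mulC D).
move: (ntr _) (ntr _) (ntr _) (ntr _) => n1 n2 n3 n4 h.
rewrite -subr_ge0; apply: le_trans h _.
by rewrite le_eqVlt; apply/orP; left; apply/eqP; ring.
Qed.

(** The tangent 1 + z <= e^z on the spectrum. In expectation it yields m >= 1, since the trace of
    the Stein matrix has mean zero, and r >= 0, since that of the conditional variance has
    nonnegative mean. *)
Lemma ntr_mexp_ge1 X (s : R) : (0 < d)%N -> X \is hermsymmx ->
  1 + s * ntr X <= ntr (mexp (s%:C *: X)).
Proof.
move=> d0 hX; rewrite mexp_mxfun//.
have [e eE] := abstracted (fun x => expR (s * x)).
have [one oneE] := abstracted (fun _ : R => 1 : R).
have [idf idE] := abstracted (@id R).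
have := @trace_ineq _ _ X X
  [:: (1, (e, one)); (- 1, (one, one)); (- s, (idf, one))].
rewrite unlock /= => /(_ _)/wrap[x y|].
  by have := expR_ge1Dx (s * x); rewrite eE oneE idE; lra.
have -> : mxfun one X = 1%:M by rewrite oneE mxfun1.
have -> : mxfun idf X = X by rewrite idE (mxfun_id hX).
rewrite -eE; move: (mxfun e X) => E.
rewrite (mulmx1 E) (mulmx1 1%:M) (mulmx1 X) (ntr1 d0).
by move: (ntr _) (ntr _) => n1 n2; lra.
Qed.

End trace_inequalities.

(** * Expectation of bounded measurable functions *)

Section bounded_measurable.
Context {R : realType} {dT : measure_display} {T : measurableType dT}.
Implicit Types f g : T -> R.

(** Bounded measurable functions form an algebra on which expectation is linear without
    integrability side conditions. *)
Definition bmf f := measurable_fun setT f /\ exists K : R, forall x, `|f x| <= K.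

Lemma bmf_cst (r : R) : bmf (fun=> r).
Proof. by split => //; exists `|r|. Qed.

Lemma bmfD f g : bmf f -> bmf g -> bmf (fun x => f x + g x).
Proof.
move=> [mf [K fK]] [mg [L gL]]; split; first exact: measurable_funD.
by exists (K + L) => x; rewrite (le_trans (ler_normD _ _))// lerD.
Qed.

Lemma bmfM f g : bmf f -> bmf g -> bmf (fun x => f x * g x).
Proof.
move=> [mf [K fK]] [mg [L gL]]; split; first exact: measurable_funM.
by exists (K * L) => x; rewrite normrM ler_pM.
Qed.

Lemma bmfZ (r : R) f : bmf f -> bmf (fun x => r * f x).
Proof. by move=> bf; apply: (bmfM _ bf); exact: bmf_cst. Qed.

Lemma bmfN f : bmf f -> bmf (fun x => - f x).
Proof. by move=> /(bmfZ (-1)); under eq_fun do rewrite mulN1r. Qed.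

Lemma bmfB f g : bmf f -> bmf g -> bmf (fun x => f x - g x).
Proof. by move=> bf /bmfN; exact: bmfD. Qed.

Lemma bmf_sum I (r : seq I) (F : I -> T -> R) :
  (forall i, bmf (F i)) -> bmf (fun x => \sum_(i <- r) F i x).
Proof.
move=> bF; elim: r => [|i r ih].
  by under eq_fun do rewrite big_nil; exact: bmf_cst.
by under eq_fun do rewrite big_cons; exact: bmfD.
Qed.

End bounded_measurable.

Lemma bmf_comp {R : realType} (d1 d2 : measure_display) (T1 : measurableType d1)
    (T2 : measurableType d2) (f : T2 -> R) (h : T1 -> T2) :
  bmf f -> measurable_fun setT h -> bmf (f \o h).
Proof.
move=> [mf [K fK]] mh; split; first exact: measurableT_comp.
by exists K => x; exact: fK.
Qed.

Lemma bmf_indic {R : realType} (dT : measure_display) (T : measurableType dT) (A : set T) :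
  measurable A -> bmf (fun x => \1_A x : R).
Proof.
move=> mA; split; first exact: measurable_indic.
by exists 1 => w; rewrite indicE; case: (_ \in _); rewrite ?normr1 ?normr0.
Qed.

Section clamp.
Context {R : realType}.
Implicit Types K x : R.

Definition clamp K x := Num.max (- K) (Num.min K x).

Lemma clamp_norm K x : 0 <= K -> `|clamp K x| <= K.
Proof.
move=> K0; rewrite /clamp ler_norml ge_max le_max lexx/= ge_min lexx/=.
by rewrite andbT (le_trans _ K0)// oppr_le0.
Qed.

Lemma clamp_id K x : `|x| <= K -> clamp K x = x.
Proof.
by rewrite ler_norml => /andP[Kx xK]; rewrite /clamp (min_idPr _)// (max_idPr _).
Qed.

(** Oddness keeps a clamped matrix Hermitian: the imaginary parts of opposite entries stay
    opposite. *)
Lemma clampN K x : 0 <= K -> clamp K (- x) = - clamp K x.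
Proof.
move=> K0; rewrite /clamp oppr_max opprK oppr_min.
have [h1|h1] := leP (- x) K; have [h2|h2] := leP (- K) (- x).
- by rewrite min_r// max_r// min_r.
- by rewrite min_r//; lra.
- by rewrite (min_l (ltW h1)) max_r//; lra.
- by exfalso; lra.
Qed.

Lemma measurable_clamp K : measurable_fun setT (clamp K).
Proof.
by apply: measurable_maxr => //; apply: measurable_minr.
Qed.

Lemma bmf_clamp K dT (T : measurableType dT) (f : T -> R) : 0 <= K ->
  measurable_fun setT f -> bmf (fun w => clamp K (f w)).
Proof.
move=> K0 mf; split; last by exists K => w; exact: clamp_norm.
by apply: measurableT_comp mf; exact: measurable_clamp.
Qed.

End clamp.

Section bounded_expectation.
Context {R : realType} {dO : measure_display} {Omega : measurableType dO}.
Variable P : probability Omega R.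
Implicit Types f g : Omega -> R.

Lemma bmf_integrable f : bmf f -> P.-integrable setT (EFin \o f).
Proof.
move=> [mf [K fK]]; apply: measurable_bounded_integrable => //.
  by rewrite (le_lt_trans (probability_le1 _ _))// ltry.
by exists K; split; [exact: num_real|move=> M KM x _;
  exact: le_trans (fK x) (ltW KM)].
Qed.

Definition Ex f : R := \int[P]_w f w.

Lemma Ex_cst r : Ex (fun=> r) = r.
Proof. rewrite /Ex Rintegral_cst//.
transitivity (r * fine (1%E : \bar R)); last by rewrite mulr1.
by congr (_ * fine _); exact: probability_setT. Qed.

Lemma ExD f g : bmf f -> bmf g -> Ex (fun w => f w + g w) = Ex f + Ex g.
Proof. by move=> bf bg; rewrite /Ex RintegralD//; exact: bmf_integrable. Qed.

Lemma ExZ r f : bmf f -> Ex (fun w => r * f w) = r * Ex f.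
Proof. by move=> bf; rewrite /Ex RintegralZl//; exact: bmf_integrable. Qed.

Lemma ExN f : bmf f -> Ex (fun w => - f w) = - Ex f.
Proof. by move=> /(ExZ (-1)); under eq_fun do rewrite mulN1r; rewrite mulN1r. Qed.

Lemma ExB f g : bmf f -> bmf g -> Ex (fun w => f w - g w) = Ex f - Ex g.
Proof. by move=> bf bg; rewrite ExD ?ExN//; exact: bmfN. Qed.

Lemma Ex_sum I (r : seq I) (F : I -> Omega -> R) : (forall i, bmf (F i)) ->
  Ex (fun w => \sum_(i <- r) F i w) = \sum_(i <- r) Ex (F i).
Proof.
move=> bF; elim: r => [|i r ih].
  by under eq_fun do rewrite big_nil; rewrite big_nil Ex_cst.
under eq_fun do rewrite big_cons; rewrite big_cons ExD ?ih//.
exact: bmf_sum.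
Qed.

Lemma Ex_le f g : bmf f -> bmf g -> (forall w, f w <= g w) -> Ex f <= Ex g.
Proof. by move=> bf bg fg; apply: le_Rintegral => //; exact: bmf_integrable. Qed.

Lemma EFin_Ex f : bmf f -> (\int[P]_w (f w)%:E)%E = (Ex f)%:E.
Proof.
move=> bf; rewrite /Ex /Rintegral fineK//.
by apply: integrable_fin_num => //; exact: bmf_integrable.
Qed.

End bounded_expectation.

Section exchangeability.
Context {R : realType} {dO dU : measure_display} {Omega : measurableType dO}
  {U : measurableType dU}.
Variable P : probability Omega R.

Lemma Ex_eq_law (phi psi : Omega -> U) (G : U -> R) :
  measurable_fun setT phi -> measurable_fun setT psi ->
  (forall A : set U, measurable A -> P (phi @^-1` A) = P (psi @^-1` A)) ->
  bmf G -> Ex P (G \o phi) = Ex P (G \o psi).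
Proof.
move=> mphi mpsi law bG.
pose phi' : {mfun Omega >-> U} :=
  HB.pack phi (isMeasurableFun.Build _ _ _ _ _ mphi).
pose psi' : {mfun Omega >-> U} :=
  HB.pack psi (isMeasurableFun.Build _ _ _ _ _ mpsi).
have mG : measurable_fun setT (EFin \o G) by apply/measurable_EFinP; exact: bG.1.
rewrite /Ex /Rintegral; congr fine.
transitivity (\int[pushforward P phi']_(y in setT) (EFin \o G) y)%E.
  by rewrite integral_pushforward//; exact: (bmf_integrable P (bmf_comp bG mphi)).
transitivity (\int[pushforward P psi']_(y in setT) (EFin \o G) y)%E; last first.
  by rewrite integral_pushforward//; exact: (bmf_integrable P (bmf_comp bG mpsi)).
by apply: eq_measure_integral => A mA _; exact: law.
Qed.

End exchangeability.

Import HBNNSimple.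

(** * Conditional expectations given [Z] *)

Section conditional_expectation.
Context {R : realType} {dO : measure_display} {Omega : measurableType dO}.
Variable P : probability Omega R.
Context {S : ptopologicalType}.
Variable Z : Omega -> borel S.
Hypothesis mZ : measurable_fun setT Z.
Implicit Types f g k : Omega -> R.

Let mZ_pre (B : set (borel S)) : measurable B -> measurable (Z @^-1` B).
Proof. by move=> mB; rewrite -[X in measurable X]setTI; exact: mZ. Qed.

(** Orthogonality to indicators of [Z]-events extends to simple functions by linearity, to
    nonnegative bounded functions of [Z] by dominated convergence, and to signed ones by a shift. *)
Lemma Ex_pull_out0 k : bmf k ->
  (forall B : set (borel S), measurable B -> \int[P]_(w in Z @^-1` B) k w = 0) ->
  forall h : borel S -> R, bmf h -> Ex P (fun w => k w * h (Z w)) = 0.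
Proof.
move=> bk k0.
have kindic (B : set (borel S)) : measurable B ->
  Ex P (fun w => k w * \1_B (Z w)) = 0.
  move=> mB; rewrite -[RHS](k0 _ mB) Rintegral_mkcond; congr (Ex P _).
  apply/funext => w; rewrite patchE indicE.
  have -> : (w \in Z @^-1` B) = (Z w \in B) by apply/idP/idP; rewrite !inE.
  by case: ifPn => _; rewrite ?mulr1 ?mulr0.
have ksfun (s : {nnsfun borel S >-> R}) : Ex P (fun w => k w * s (Z w)) = 0.
  under eq_fun do rewrite fimfunEord mulr_sumr.
  rewrite Ex_sum => [|i].
    apply: big1 => i _; under eq_fun do rewrite mulrCA.
    rewrite ExZ ?kindic ?mulr0//.
    by apply: bmfM => //; apply: (bmf_comp (f := \1__)) mZ; exact: bmf_indic.
  apply: bmfM => //; apply: bmfZ; apply: (bmf_comp (f := \1__)) mZ;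
    exact: bmf_indic.
have kpos (h : borel S -> R) : bmf h -> (forall z, 0 <= h z) ->
    Ex P (fun w => k w * h (Z w)) = 0.
  move=> bh h0; have [mh [K hK]] := bh.
  have mEh : measurable_fun setT (EFin \o h) by exact/measurable_EFinP.
  pose s := nnsfun_approx measurableT mEh.
  have hE0 z : setT z -> (0 <= (EFin \o h) z)%E by rewrite lee_fin.
  have sh n z : s n z <= h z.
    have /fine_cvgP[_ c] := cvg_nnsfun_approx measurableT mEh hE0 (I : setT z).
    have <- : limn (fun n => s n z) = h z by apply/cvg_lim.
    apply: (nondecreasing_cvgn_le (u_ := fun n => s n z)).
      by move=> m p mp; have := nd_nnsfun_approx measurableT mEh mp; move/lefP;
        apply.
    by apply/cvg_ex; exists (h z).
  have [L kL] := bk.2.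
  have := @dominated_convergence _ _ _ P setT measurableT
    (fun n w => (k w * s n (Z w))%:E) (fun w => (k w * h (Z w))%:E) (cst (L * K)%:E).
  case.
  - move=> n; apply/measurable_EFinP; apply: measurable_funM; first exact: bk.1.
    exact: measurableT_comp.
  - by apply/measurable_EFinP; apply: measurable_funM;
    [exact: bk.1|exact: measurableT_comp].
  - apply: aeW => w _; under eq_fun do rewrite EFinM; rewrite EFinM.
    apply: cvgeZl => //; exact: (cvg_nnsfun_approx measurableT mEh hE0).
  - by apply: finite_measure_integrable_cst.
  - apply: aeW => w n _; rewrite abse_EFin lee_fin normrM ler_pM//.
    rewrite ger0_norm// (le_trans _ (hK (Z w)))// ger0_norm//.
  move=> _ _ c; rewrite /Ex /Rintegral.
  move/cvg_lim : c => <-//.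
  rewrite (_ : [sequence _]_n = cst 0%E) ?lim_cst//.
  apply/funext => n /=; rewrite EFin_Ex ?ksfun//.
  apply: bmfM => //; apply: (bmf_comp (f := s n)) mZ; split => //.
  by exists K => z; rewrite ger0_norm// (le_trans (sh n z))//
    (le_trans (ler_norm _)).
move=> h bh; have [mh [K hK]] := bh.
(* [h] is the difference of the nonnegative functions [h + K] and [K]. *)
have bhK : bmf (fun z => h z + K) by apply: bmfD => //; exact: bmf_cst.
have := kpos _ bhK => /(_ _)/wrap[z|].
  by have := hK z; rewrite ler_norml => /andP[? _]; rewrite -lerBlDr sub0r.
have := kpos (cst K) (bmf_cst _) => /(_ _)/wrap[z|].
  by rewrite (le_trans _ (hK z)).
move=> h1 h2; rewrite -[RHS]h2 -[LHS]addr0 -[in LHS]h1 -ExD.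
- by congr (Ex P _); apply/funext => w; rewrite mulrDr.
- by apply: bmfM => //; exact: (bmf_comp bh mZ).
- by apply: bmfM => //; exact: (bmf_comp (bmf_cst K) mZ).
Qed.

(** [f'] and [g'] are bounded modifications of [f] and [g] on null sets, which integrals over
    [Z]-events do not see. *)
Lemma Ex_pull_out f g f' g' : is_condexp P Z f g -> bmf f' -> bmf g' ->
  {ae P, forall w, f w = f' w} -> {ae P, forall w, g w = g' w} ->
  forall h : borel S -> R, bmf h ->
  Ex P (fun w => f' w * h (Z w)) = Ex P (fun w => g' w * h (Z w)).
Proof.
move=> [fi _ gi fg] bf bg ff gg h bh.
have bhZ : bmf (h \o Z) by exact: bmf_comp.
apply/eqP; rewrite -subr_eq0 -ExB; [|exact: bmfM..].
under eq_fun do rewrite -mulrBl.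
apply/eqP; apply: (Ex_pull_out0 (k := fun w => f' w - g' w)) => //;
  first exact: bmfB.
move=> B mB.
have mB_int (F : Omega -> R) : P.-integrable setT (EFin \o F) ->
    measurable_fun (Z @^-1` B) (EFin \o F).
  by move=> /measurable_int; exact: measurable_funS.
rewrite RintegralB; [|exact: mZ_pre|..]; last 2 first.
- by apply: integrableS (bmf_integrable P bf) => //; exact: mZ_pre.
- by apply: integrableS (bmf_integrable P bg) => //; exact: mZ_pre.
apply/eqP; rewrite subr_eq0; apply/eqP; rewrite /Rintegral; congr fine.
transitivity (\int[P]_(w in Z @^-1` B) (f w)%:E)%E.
  apply: ae_eq_integral; [exact: mZ_pre|exact/mB_int/bmf_integrable|exact: mB_int|].
  by apply: filterS ff => w -> _.
rewrite -fg//.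
apply: ae_eq_integral; [exact: mZ_pre|exact: mB_int|exact/mB_int/bmf_integrable|].
by apply: filterS gg => w -> _.
Qed.

(** The event [N] where g1 > g2 is a [Z]-event, so the integral of g1 - g2 over it equals that of f1
    - f2, which is at most 0. The integrand being positive on [N], this event is null. *)
Lemma condexp_le f1 g1 f2 g2 : is_condexp P Z f1 g1 -> is_condexp P Z f2 g2 ->
  {ae P, forall w, f1 w <= f2 w} -> {ae P, forall w, g1 w <= g2 w}.
Proof.
move=> [if1 mg1 ig1 e1] [if2 mg2 ig2 e2] f12.
pose N := [set w | 0 < g1 w - g2 w].
have : measurable (N : set (g_sigma_algebra_preimageType Z)).
  have : measurable_fun setT
     ((fun w => g1 w - g2 w) : g_sigma_algebra_preimageType Z -> R).
    exact: measurable_funB.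
  move=> /(_ measurableT `]0, +oo[%classic (measurable_itv _)).
  rewrite setTI; congr (measurable _); apply/seteqP; split => w /=;
    by rewrite in_itv/= andbT.
move=> [B mB]; rewrite setTI => BN.
have mN : measurable N by rewrite -BN; exact: mZ_pre.
have intN f : P.-integrable setT (EFin \o f) -> P.-integrable N (EFin \o f).
  by apply: integrableS.
have mNf f : P.-integrable setT (EFin \o f) -> measurable_fun N (EFin \o f).
  by move=> /intN /measurable_int.
have le0 : (\int[P]_(w in N) (g1 w)%:E <= \int[P]_(w in N) (g2 w)%:E)%E.
  rewrite -BN e1// e2//; rewrite BN.
  rewrite -subre_ge0; last by apply: integrable_fin_num => //; exact: intN.
  rewrite -integralB//; [|exact: intN..].
  rewrite (_ : integral _ _ _ = \int[P]_(w in N) `|(f2 w)%:E - (f1 w)%:E|)%E.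
    exact: integral_ge0.
  apply: ae_eq_integral => //.
  - by apply: emeasurable_funB; exact: mNf.
  - by apply: measurableT_comp => //; apply: emeasurable_funB; exact: mNf.
  - by apply: filterS f12 => w ? _; rewrite gee0_abs// -EFinB lee_fin subr_ge0.
have abs0 : (\int[P]_(w in N) `|(g1 w - g2 w)%:E| = 0)%E.
  apply/eqP; rewrite eq_le integral_ge0// andbT.
  under eq_integral => w wN.
    rewrite gee0_abs; last by rewrite lee_fin ltW//; exact: set_mem wN.
    rewrite EFinB; over.
  rewrite integralB//; [|exact: intN..].
  rewrite sube_le0//.
have : ae_eq P N (fun w => (g1 w - g2 w)%:E) (cst 0%E).
  apply/ae_eq_integral_abs => //.
  by under eq_fun do rewrite EFinB; apply: emeasurable_funB; exact: mNf.
apply: filterS => w Nw; rewrite leNgt; apply/negP => g21.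
have : N w by rewrite /N/= subr_gt0.
by move=> h; have e := EFin_inj (Nw h); move: h; rewrite /N/= e ltxx.
Qed.

End conditional_expectation.

(** * Random matrices *)

Section measurable_matrices.
Context {R : realType} {dT : measure_display} {T : measurableType dT} {d : nat}.
Implicit Types F G : T -> 'M[R[i]]_d.

Section closed_class.
(** [C] is instantiated with the measurable functions and with the bounded measurable ones. *)
Variable C : (T -> R) -> Prop.
Hypothesis C_cst : forall r : R, C (fun=> r).
Hypothesis C_add : forall f g, C f -> C g -> C (fun w => f w + g w).
Hypothesis C_mul : forall f g, C f -> C g -> C (fun w => f w * g w).

Definition mx_class F := forall i j,
  C (fun w => complex.Re (F w i j)) /\ C (fun w => complex.Im (F w i j)).

Lemma class_sum I (r : seq I) (h : I -> T -> R) :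
  (forall i, C (h i)) -> C (fun w => \sum_(i <- r) h i w).
Proof.
move=> Ch; elim: r => [|i r ih].
  by under eq_fun do rewrite big_nil; exact: C_cst.
by under eq_fun do rewrite big_cons; exact: C_add.
Qed.

Lemma class_opp f : C f -> C (fun w => - f w).
Proof. by move=> Cf; under eq_fun do rewrite -mulN1r; apply: C_mul. Qed.

Lemma mx_class_cst (A : 'M[R[i]]_d) : mx_class (fun=> A).
Proof. by move=> i j; split; exact: C_cst. Qed.

Lemma mx_classD F G : mx_class F -> mx_class G -> mx_class (fun w => F w + G w).
Proof.
move=> cF cG i j; have [[F1 F2] [G1 G2]] := (cF i j, cG i j); split.
- by under eq_fun do rewrite mxE Re_add; exact: C_add.
- by under eq_fun do rewrite mxE Im_add; exact: C_add.
Qed.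

Lemma mx_classZ (r : R) F : mx_class F -> mx_class (fun w => r%:C *: F w).
Proof.
move=> cF i j; have [F1 F2] := cF i j; split.
- by under eq_fun do rewrite mxE Re_scale; exact: C_mul.
- by under eq_fun do rewrite mxE Im_scale; exact: C_mul.
Qed.

Lemma mx_classN F : mx_class F -> mx_class (fun w => - F w).
Proof.
by move=> /(mx_classZ (-1)); under eq_fun do rewrite rmorphN1 scaleN1r.
Qed.

Lemma mx_classB F G : mx_class F -> mx_class G -> mx_class (fun w => F w - G w).
Proof. by move=> cF /mx_classN; exact: mx_classD. Qed.

Lemma mx_classM F G : mx_class F -> mx_class G -> mx_class (fun w => F w *m G w).
Proof.
move=> cF cG i j; split.
- under eq_fun do rewrite mxE Re_sum; apply: class_sum => k.
  under eq_fun do rewrite Re_mul.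
  by apply: C_add; [|apply: class_opp]; apply: C_mul;
    [case: (cF i k)|case: (cG k j)|case: (cF i k)|case: (cG k j)].
- under eq_fun do rewrite mxE Im_sum; apply: class_sum => k.
  under eq_fun do rewrite Im_mul.
  by apply: C_add; apply: C_mul;
    [case: (cF i k)|case: (cG k j)|case: (cF i k)|case: (cG k j)].
Qed.

Lemma mx_classX k F : mx_class F -> mx_class (fun w => F w ^+ k).
Proof.
move=> cF; elim: k => [|k ih].
  by under eq_fun do rewrite expr0; exact: mx_class_cst.
by under eq_fun do rewrite exprS; exact: mx_classM.
Qed.

Lemma class_ntr F : mx_class F -> C (fun w => ntr (F w)).
Proof.
move=> cF; under eq_fun do rewrite ntrE /mxtrace Re_sum.
by apply: C_mul => //; apply: class_sum => i; case: (cF i i).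
Qed.

End closed_class.

Definition mx_mfun := mx_class (fun f : T -> R => measurable_fun setT f).
Definition mx_bmf := mx_class (@bmf R dT T).

Lemma mx_bmf_mfun F : mx_bmf F -> mx_mfun F.
Proof. by move=> bF i j; have [[? _] [? _]] := bF i j. Qed.

Lemma mx_mfun_mexp F : mx_mfun F -> mx_mfun (fun w => mexp (F w)).
Proof.
move=> mF; have mcst (r : R) : measurable_fun [set: T] (fun=> r) by [].
have mX k := mx_classX mcst (@measurable_funD _ _ _ _) (@measurable_funM _ _ _ _) k mF.
move=> i j; split.
- apply: (measurable_fun_cvg (h := fun n w =>
    series (fun k => complex.Re (((k`!%:R)^-1 *: F w ^+ k) i j)) n)) => [n|w _].
    apply: measurable_sum => k; under eq_fun do rewrite mxE invr_factC Re_scale.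
    by apply: measurable_funM => //; have [] := mX k i j.
  exact: Re_mexp_cvg.
- apply: (measurable_fun_cvg (h := fun n w =>
    series (fun k => complex.Im (((k`!%:R)^-1 *: F w ^+ k) i j)) n)) => [n|w _].
    apply: measurable_sum => k; under eq_fun do rewrite mxE invr_factC Im_scale.
    by apply: measurable_funM => //; have [] := mX k i j.
  exact: Im_mexp_cvg.
Qed.

Lemma mx_bmf_mxl1 F : mx_bmf F -> exists K : R, forall w, mxl1 (F w) <= K.
Proof.
move=> bF.
have bnorm (f : T -> R) : bmf f -> bmf (fun w => `|f w|).
  move=> [mf [K fK]]; split; first exact: measurableT_comp.
  by exists K => w; rewrite normr_id.
have [_ [K hK]] : bmf (fun w => mxl1 (F w)).
  apply: bmf_sum => i; apply: bmf_sum => j.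
  by have [? ?] := bF i j; apply: bmfD; exact: bnorm.
by exists K => w; exact: le_trans (ler_norm _) (hK w).
Qed.

Lemma mx_bmf_mexp F : mx_bmf F -> mx_bmf (fun w => mexp (F w)).
Proof.
move=> bF i j; have [mR mI] := mx_mfun_mexp (mx_bmf_mfun bF) i j.
have [K hK] := mx_bmf_mxl1 bF.
split; split => //; exists (expR K) => w.
- by rewrite (le_trans (Re_mexp_le _ _ _))// ler_expR.
- by rewrite (le_trans (Im_mexp_le _ _ _))// ler_expR.
Qed.

Lemma mx_bmfB F G : mx_bmf F -> mx_bmf G -> mx_bmf (fun w => F w - G w).
Proof. by apply: mx_classB; [exact: bmf_cst|exact: bmfD|exact: bmfM]. Qed.

Lemma mx_bmfM F G : mx_bmf F -> mx_bmf G -> mx_bmf (fun w => F w *m G w).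
Proof. by apply: mx_classM; [exact: bmf_cst|exact: bmfD|exact: bmfM]. Qed.

Lemma mx_bmfX k F : mx_bmf F -> mx_bmf (fun w => F w ^+ k).
Proof. by apply: mx_classX; [exact: bmf_cst|exact: bmfD|exact: bmfM]. Qed.

Lemma mx_bmfZ (r : R) F : mx_bmf F -> mx_bmf (fun w => r%:C *: F w).
Proof. by apply: mx_classZ; [exact: bmf_cst|exact: bmfM]. Qed.

Lemma bmf_ntr F : mx_bmf F -> bmf (fun w => ntr (F w)).
Proof. by apply: class_ntr; [exact: bmf_cst|exact: bmfD|exact: bmfM]. Qed.

Lemma mfun_ntr F : mx_mfun F -> measurable_fun setT (fun w => ntr (F w)).
Proof.
apply: class_ntr => [r|f g|f g] //; first exact: measurable_funD.
exact: measurable_funM.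
Qed.

End measurable_matrices.

Lemma mx_bmf_comp {R : realType} (d1 d2 : measure_display) (T1 : measurableType d1)
    (T2 : measurableType d2) d (F : T2 -> 'M[R[i]]_d) (h : T1 -> T2) :
  mx_bmf F -> measurable_fun setT h -> mx_bmf (F \o h).
Proof.
move=> bF mh i j; have [b1 b2] := bF i j.
by split; [exact: (bmf_comp b1 mh)|exact: (bmf_comp b2 mh)].
Qed.

Section pull_out_trace.
Context {R : realType} {dO : measure_display} {Omega : measurableType dO}.
Variable P : probability Omega R.
Context {S : ptopologicalType} {d : nat}.
Variable Z : Omega -> borel S.
Hypothesis mZ : measurable_fun setT Z.
Implicit Types (F G : Omega -> 'M[R[i]]_d) (H : borel S -> 'M[R[i]]_d).

(** Equality of E[F | Z] and E[G | Z], tested against bounded functions of [Z]. Being a statement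
    about expectations, it is insensitive to null sets. *)
Definition same_condexp F G := forall (h : borel S -> R) i j, bmf h ->
  Ex P (fun w => complex.Re (F w i j) * h (Z w)) =
  Ex P (fun w => complex.Re (G w i j) * h (Z w)) /\
  Ex P (fun w => complex.Im (F w i j) * h (Z w)) =
  Ex P (fun w => complex.Im (G w i j) * h (Z w)).

Lemma Ex_ntr_pull_out F G H : mx_bmf F -> mx_bmf G -> mx_bmf H ->
  same_condexp F G ->
  Ex P (fun w => ntr (F w *m H (Z w))) = Ex P (fun w => ntr (G w *m H (Z w))).
Proof.
move=> bF bG bH FG.
have bHZ : mx_bmf (H \o Z) by exact: mx_bmf_comp.
have expand (F' : Omega -> 'M[R[i]]_d) : mx_bmf F' ->
    Ex P (fun w => ntr (F' w *m H (Z w))) = d%:R^-1 * \sum_i \sum_j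
    (Ex P (fun w => complex.Re (F' w i j) * complex.Re (H (Z w) j i)) -
     Ex P (fun w => complex.Im (F' w i j) * complex.Im (H (Z w) j i))).
  move=> bF'; under eq_fun do rewrite ntrE /mxtrace Re_sum.
  have bRe i j : bmf (fun w => complex.Re (F' w i j) * complex.Re (H (Z w) j i)).
    by have [? _] := bF' i j; have [? _] := bHZ j i; exact: bmfM.
  have bIm i j : bmf (fun w => complex.Im (F' w i j) * complex.Im (H (Z w) j i)).
    by have [_ ?] := bF' i j; have [_ ?] := bHZ j i; exact: bmfM.
  have bsum i : bmf (fun w => \sum_j (complex.Re (F' w i j) * complex.Re (H (Z w) j i)
      - complex.Im (F' w i j) * complex.Im (H (Z w) j i))).
    by apply: bmf_sum => j; exact: bmfB.
  rewrite [LHS](_ : _ = Ex P (fun w => d%:R^-1 * \sum_i \sum_j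
      (complex.Re (F' w i j) * complex.Re (H (Z w) j i)
      - complex.Im (F' w i j) * complex.Im (H (Z w) j i)))); last first.
    congr (Ex P _); apply/funext => w; congr (_ * _); apply: eq_bigr => i _.
    by rewrite mxE Re_sum; apply: eq_bigr => j _; rewrite Re_mul.
  rewrite ExZ; last exact: bmf_sum.
  congr (_ * _); rewrite Ex_sum//; apply: eq_bigr => i _.
  by rewrite Ex_sum => [|j]; [apply: eq_bigr => j _; rewrite ExB|exact: bmfB].
rewrite !expand//; congr (_ * _); apply: eq_bigr => i _; apply: eq_bigr => j _.
have [bHR bHI] := bH j i.
by rewrite (FG _ i j bHR).1 (FG _ i j bHI).2.
Qed.

End pull_out_trace.

(** * The moment generating function *)

Lemma ler0_is_derive_le {R : realType} (f df : R -> R) (a b : R) : a <= b ->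
  (forall x : R, is_derive x (1 : R) f (df x)) ->
  (forall x, a < x < b -> df x <= 0) -> f b <= f a.
Proof.
move=> ab fd df0.
have cf : {within `[a, b], continuous f}.
  apply: continuous_subspaceT => x.
  by apply/differentiable_continuous/derivable1_diffP; have [] := fd x.
apply: (@ler0_derive1_le_cc _ f a b) => //; rewrite ?in_itv/= ?lexx ?ab//.
by move=> x; rewrite in_itv/= => xab; rewrite derive1E; have [_ ->] := fd x;
  exact: df0.
Qed.

Lemma hermsymmxB {C : numClosedFieldType} n (A B : 'M[C]_n) :
  A \is hermsymmx -> B \is hermsymmx -> A - B \is hermsymmx.
Proof.
move=> /is_hermitianmxP eA /is_hermitianmxP eB; apply/is_hermitianmxP.
by rewrite expr0 !scale1r in eA eB *; rewrite raddfB/= map_mxB -eA -eB.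
Qed.

Lemma mexp0 {R : realType} {d} (A : 'M[R[i]]_d) : A \is hermsymmx ->
  mexp (0%:C *: A) = 1%:M.
Proof.
move=> hA; rewrite (mexp_mxfun 0 hA) -(mxfun1 A); congr mxfun.
by apply/funext => x; rewrite mul0r expR0.
Qed.

Lemma ntr_sqr_ge0 {R : realType} {d} (A : 'M[R[i]]_d) : A \is hermsymmx ->
  0 <= ntr (A ^+ 2).
Proof.
move=> hA; rewrite -{1}(mxfun_id hA) -mxfunX ntr_mxfun mulr_ge0 ?invr_ge0//.
by rewrite sumr_ge0// => i _; rewrite sqr_ge0.
Qed.

Opaque mexp.

Section entropy_method.
Context {R : realType} {dO : measure_display} {Omega : measurableType dO}.
Variable P : probability Omega R.
(* For a matrix Stein pair (X, X') with conditional variance D, the functions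
   below are the normalized traces of e^{sX} (e), X e^{sX} (x), D e^{sX} (v),
   e^{sD} (eD), (X - X') e^{sX} (a), (X - X') e^{sX'} (a'),
   (X - X')^2 e^{sX} (q) and (X - X')^2 e^{sX'} (q'). *)
Variables (e x v eD a a' q q' : R -> Omega -> R) (alpha : R).
Hypothesis e_bmf : forall s, bmf (e s).
Hypothesis x_bmf : forall s, bmf (x s).
Hypothesis v_bmf : forall s, bmf (v s).
Hypothesis eD_bmf : forall s, bmf (eD s).
Hypothesis a_bmf : forall s, bmf (a s).
Hypothesis a'_bmf : forall s, bmf (a' s).
Hypothesis q_bmf : forall s, bmf (q s).
Hypothesis q'_bmf : forall s, bmf (q' s).
Hypothesis alpha_gt0 : 0 < alpha.
Hypothesis mean_value : forall s w, 0 <= s ->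
  a s w - a' s w <= s / 2 * (q s w + q' s w).
Hypothesis young : forall psi s c l w,
  expR (- l) * (psi * v s w + (l - c + 1) * e s w - s * x s w) <=
  expR (- c) * eD psi w.
Hypothesis e_ge : forall s w, 1 + s * x 0 w <= e s w.
Hypothesis eD_ge : forall s w, 1 + s * v 0 w <= eD s w.
Hypothesis q0_ge0 : forall w, 0 <= q 0 w.
Hypothesis e0 : forall w, e 0 w = 1.
Hypothesis aa'0 : forall w, a 0 w = a' 0 w.
Hypothesis e_derive : forall (t : R) w, is_derive t (1 : R) (e ^~ w) (x t w).
Hypothesis x_bound : forall b, exists C, forall t w, `|t| <= b -> `|x t w| <= C.
Hypothesis stein : forall s, Ex P (a s) = alpha * Ex P (x s).
Hypothesis variance : forall s, Ex P (q s) = 2 * alpha * Ex P (v s).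
Hypothesis swap1 : forall s, Ex P (a s) = - Ex P (a' s).
Hypothesis swap2 : forall s, Ex P (q s) = Ex P (q' s).

Local Notation mgf s := (Ex P (e s)).
Local Notation dmgf s := (Ex P (x s)).

(** E a - E a' is 2 alpha m'(s) and E q + E q' is 4 alpha E v, so [alpha] cancels. *)
Lemma dmgf_le s : 0 <= s -> dmgf s <= s * Ex P (v s).
Proof.
move=> s0.
have bqq := bmfD (q_bmf s) (q'_bmf s).
have key : Ex P (a s) - Ex P (a' s) <= s / 2 * (Ex P (q s) + Ex P (q' s)).
  rewrite -(ExB P (a_bmf s) (a'_bmf s)) -(ExD P (q_bmf s) (q'_bmf s))
    -(ExZ P _ bqq).
  apply: (Ex_le _ (bmfB (a_bmf s) (a'_bmf s)) (bmfZ _ bqq)) => w.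
  exact: mean_value.
rewrite -(swap2 s) -[- Ex _ _](swap1 s) (stein s) (variance s) in key.
rewrite -(ler_pM2l alpha_gt0); move: key.
move: (Ex _ _) (Ex _ _) => g u; lra.
Qed.

Lemma mgf_ge1 s : 1 <= mgf s.
Proof.
(* At s = 0 the families [a] and [a'] coincide, so the swap gives E a = - E a, and the Stein
   condition turns this into E tr X = 0. *)
have Ex0 : Ex P (x 0) = 0.
  have h : Ex P (a 0) = Ex P (a' 0) by congr (Ex P _); apply/funext => w.
  have /eqP : alpha * Ex P (x 0) = 0.
    by rewrite -stein; have := swap1 0; rewrite -h; lra.
  by rewrite mulf_eq0 gt_eqF//= => /eqP.
rewrite (_ : 1 = Ex P (fun w => 1 + s * x 0 w)).
  exact: (Ex_le _ (bmfD (bmf_cst _) (bmfZ s (x_bmf 0))) (e_bmf s)).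
by rewrite (ExD P (bmf_cst _) (bmfZ s (x_bmf 0))) Ex_cst (ExZ P s (x_bmf 0)) Ex0 mulr0 addr0.
Qed.

Lemma Ex_eD_ge1 psi : 0 <= psi -> 1 <= Ex P (eD psi).
Proof.
move=> psi0.
have D0 : 0 <= Ex P (v 0).
  have : 0 <= 2 * alpha * Ex P (v 0) by rewrite -variance; exact: Rintegral_ge0.
  by rewrite pmulr_rge0// mulr_gt0.
apply: (@le_trans _ _ (Ex P (fun w => 1 + psi * v 0 w))).
  rewrite (ExD P (bmf_cst _) (bmfZ psi (v_bmf 0))) Ex_cst (ExZ P psi (v_bmf 0)).
  by rewrite lerDl mulr_ge0.
exact: (Ex_le _ (bmfD (bmf_cst _) (bmfZ psi (v_bmf 0))) (eD_bmf psi)).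
Qed.

Local Notation r psi := (psi^-1 * ln (Ex P (eD psi))).

Lemma ln_Ex_eD_ge0 psi : 0 < psi -> 0 <= r psi.
Proof.
move=> psi0; rewrite mulr_ge0 ?invr_ge0 ?(ltW psi0)// ln_ge0//.
by apply: Ex_eD_ge1; exact: ltW.
Qed.

Lemma dmgf_entropy psi s : 0 < psi -> 0 <= s ->
  dmgf s * (1 - s ^+ 2 / psi) <= s * r psi * mgf s.
Proof.
move=> psi0 s0.
have M1 := Ex_eD_ge1 (ltW psi0); have M0 := lt_le_trans ltr01 M1.
have m1 := mgf_ge1 s; have m0 := lt_le_trans ltr01 m1.
have l0 : 0 <= ln (mgf s) by exact: ln_ge0.
have b1 := bmfZ psi (v_bmf s).
have yE : expR (- ln (mgf s)) * (psi * Ex P (v s) +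
    (ln (mgf s) - ln (Ex P (eD psi)) + 1) * mgf s - s * dmgf s) <=
    expR (- ln (Ex P (eD psi))) * Ex P (eD psi).
  move: (ln (mgf s)) (ln (Ex P (eD psi))) => l c.
  have b2 := bmfZ (l - c + 1) (e_bmf s); have b3 := bmfZ s (x_bmf s).
  have b := bmfB (bmfD b1 b2) b3.
  rewrite -(ExZ P _ (v_bmf s)) -(ExZ P _ (e_bmf s)) -(ExZ P _ (x_bmf s)).
  rewrite -(ExZ P _ (eD_bmf psi)) -(ExD P b1 b2) -(ExB P (bmfD b1 b2) b3)
    -(ExZ P _ b).
  apply: (Ex_le _ (bmfZ _ b) (bmfZ _ (eD_bmf psi))) => w.
  exact: young.
(* Taking l = ln m and c = ln E eD normalizes both exponentials, leaving psi E v + (l - c + 1) m - s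
   m' <= m; the term l m is then dropped, as l >= 0. *)
rewrite !expRN !lnK ?posrE// mulVf ?gt_eqF// ler_pdivrMl// mulr1 in yE.
have := dmgf_le s0; move: yE l0.
move: (Ex P (v s)) (dmgf s) (ln (mgf s)) => u g l.
move: (mgf s) m0 (ln (Ex P (eD psi))) => m m0 c yE l0 gv.
have gv' : psi * g <= s * (psi * u) by rewrite mulrCA ler_pM2l.
have : s * (psi * u) <= s * (c * m + s * g).
  rewrite ler_wpM2l//.
  have : 0 <= l * m by rewrite mulr_ge0// ltW.
  move: yE; rewrite mulrDl mulrBl mul1r; lra.
move=> h; have {gv' h}h := le_trans gv' h.
rewrite -(ler_pM2l psi0).
have -> : psi * (g * (1 - s ^+ 2 / psi)) = psi * g - s ^+ 2 * g by field;
  rewrite gt_eqF.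
have -> : psi * (s * (psi^-1 * c) * m) = s * (c * m) by field; rewrite gt_eqF.
by move: h; rewrite mulrDr expr2 -mulrA; lra.
Qed.

Lemma is_derive_mgf (s : R) : is_derive s (1 : R) (fun t => mgf t) (dmgf s).
Proof.
(* A bounded window around [s], on which the derivative has a bound uniform in the sample point, as
   differentiation under the integral requires. *)
pose b := `|s| + 1.
have [C xC] := x_bound b.
have sI : (`](- b), b[%classic : set R) s.
  by rewrite /= in_itv/= -ltr_norml /b ltrDl.
have C0 (w : Omega) : 0 <= C.
  by rewrite (le_trans _ (xC s w _))// /b lerDl.
have intf t : (`](- b), b[%classic : set R) t -> P.-integrable setT (EFin \o e t).
  by move=> _; exact: bmf_integrable.
have derf t w : (`](- b), b[%classic : set R) t -> setT w -> derivable (e ^~ w) t 1.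
  by move=> _ _; have [] := e_derive t w.
have intC : P.-integrable setT (EFin \o (fun=> C)).
  by apply: bmf_integrable; exact: bmf_cst.
have deE t w : partial1of2 e t w = x t w.
  by rewrite partial1of2E; have [_ ->] := e_derive t w.
have deC t w : (`](- b), b[%classic : set R) t -> setT w ->
    `|partial1of2 e t w| <= C.
  by rewrite /= in_itv/= -ltr_norml deE => tb _; exact/xC/ltW.
have drv := derivable_under_integral measurableT sI intf derf C0 intC deC.
have val := differentiation_under_integral measurableT sI intf derf C0 intC deC.
apply: DeriveDef; first exact: drv.
rewrite -derive1E; transitivity (\int[P]_y partial1of2 e s y); first exact: val.
by apply: eq_Rintegral => w _; rewrite deE.
Qed.

Lemma mgf_le psi s : 0 < psi -> 0 < s < Num.sqrt psi ->
  mgf s <= expR (r psi * s ^+ 2 / (2 * (1 - s / Num.sqrt psi))).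
Proof.
move=> psi0 /andP[s0 spsi].
have q0 : 0 < Num.sqrt psi by rewrite sqrtr_gt0.
have r0 := ln_Ex_eD_ge0 psi0.
(* Freezes the factor 1 - t^2 / psi at a constant lower bound valid for all t < s. *)
have sq t : 0 < t < s -> t ^+ 2 / psi <= s / Num.sqrt psi.
  move=> /andP[t0 ts].
  rewrite -[X in _ / X <= _](sqr_sqrtr (ltW psi0)) -expr_div_n expr2.
  have tq : t / Num.sqrt psi <= s / Num.sqrt psi.
    by rewrite ler_wpM2r ?invr_ge0 ?ltW.
  apply: le_trans tq.
  by rewrite ler_piMl ?divr_ge0 ?ltW// ltr_pdivrMr// mul1r (lt_trans ts).
have c0 : 0 < 1 - s / Num.sqrt psi by rewrite subr_gt0 ltr_pdivrMr// mul1r.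
set k := r psi / (1 - s / Num.sqrt psi).
have k0 : 0 <= k by rewrite divr_ge0// ltW.
have k1 : r psi = k * (1 - s / Num.sqrt psi) by rewrite divfK// gt_eqF.
(* Since m' <= k t m on (0, s), multiplying m by the Gaussian integrating factor gives a
   nonincreasing function. *)
pose h (t : R) := mgf t * expR (- (k / 2) * t ^+ 2).
have dh (t : R) : is_derive t (1 : R) h ((dmgf t - k * t * mgf t) * expR (- (k / 2) * t ^+ 2)).
  have dm := is_derive_mgf t.
  by apply: is_derive_eq; rewrite /GRing.scale/=; field.
have : h s <= h 0.
  apply: (ler0_is_derive_le (ltW s0) dh) => t /andP[t0 ts].
  rewrite mulr_le0_ge0 ?expR_ge0// subr_le0.
  have ent := dmgf_entropy psi0 (ltW t0).
  have m0 : 0 < mgf t by exact: lt_le_trans (mgf_ge1 t).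
  (* Shrinking the factor on the left is legitimate only when m'(t) is positive; otherwise the bound
     is trivial. *)
  have [g0|g0] := leP (dmgf t) 0.
    apply: le_trans g0 _; apply: mulr_ge0; last exact: ltW.
    by apply: mulr_ge0 => //; exact: ltW.
  rewrite -(ler_pM2r c0).
  have -> : k * t * mgf t * (1 - s / Num.sqrt psi) = t * r psi * mgf t.
    by rewrite k1; ring.
  apply: le_trans ent; rewrite ler_wpM2l ?(ltW g0)// lerD2l lerN2 sq//.
  by rewrite t0.
rewrite /h expr0n/= mulr0 expR0 mulr1.
have -> : mgf 0 = 1.
  by rewrite -[RHS](Ex_cst P); congr (Ex P _); apply/funext => w.
rewrite mulNr expRN ler_pdivrMr ?expR_gt0// mul1r => /le_trans; apply.
rewrite ler_expR le_eqVlt; apply/orP; left; apply/eqP; rewrite k1.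
move: c0; move: (1 - s / Num.sqrt psi) => c c0; field.
by rewrite gt_eqF.
Qed.

End entropy_method.

(** For fixed [A] the trace is a finite sum of scalar exponentials in [t], so no matrix-valued
    derivative is needed. *)
Lemma is_derive_ntr_mexp {R : realType} {d} (A : 'M[R[i]]_d) (t : R) : A \is hermsymmx ->
  is_derive t (1 : R) (fun u : R => ntr (mexp (u%:C *: A))) (ntr (A *m mexp (t%:C *: A))).
Proof.
move=> hA; rewrite (mexp_mxfun t hA) (mxfun_idl _ hA) ntr_mxfun.
rewrite (_ : (fun _ => _) = (fun u => d%:R^-1 * \sum_i expR (u * eigval A i)));
  last first.
  by apply/funext => u; rewrite (mexp_mxfun u hA) ntr_mxfun.
have dsum : is_derive t (1 : R) (\sum_(i < d) (fun u => expR (u * eigval A i)))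
    (\sum_(i < d) (eigval A i * expR (t * eigval A i))).
  apply: is_derive_sum => i; apply: is_derive_eq.
  by rewrite /GRing.scale/=; ring.
have -> : (fun u => d%:R^-1 * \sum_i expR (u * eigval A i)) =
    d%:R^-1 \*: (\sum_(i < d) (fun u => expR (u * eigval A i))).
  by apply/funext => u /=; rewrite fct_sumE.
exact: (is_deriveZ (d%:R^-1 : R) dsum).
Qed.

Lemma ntr_mul_mexp_bound {R : realType} {d} (A : 'M[R[i]]_d) (K b t : R) : A \is hermsymmx ->
  mxl1 A <= K -> `|t| <= b ->
  `|ntr (A *m mexp (t%:C *: A))| <=
  d%:R^-1 * \sum_(i < d) (d%:R * K * expR (b * (d%:R * K))).
Proof.
move=> hA AK tb.
have eigK i : `|eigval A i| <= d%:R * K.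
  by rewrite (le_trans (eigval_le_mxl1 _ _))// ler_wpM2l.
rewrite (mexp_mxfun t hA) (mxfun_idl _ hA) ntr_mxfun.
rewrite normrM ger0_norm ?invr_ge0//.
rewrite ler_wpM2l ?invr_ge0// (le_trans (ler_norm_sum _ _ _))// ler_sum// => i _.
rewrite normrM ler_pM// ger0_norm ?expR_ge0// ler_expR (le_trans (ler_norm _))//.
by rewrite normrM ler_pM.
Qed.

(** * Bounded matrix Stein pairs *)

Section bounded_stein_pair.
Context {R : realType} {dO : measure_display} {Omega : measurableType dO}.
Variable P : probability Omega R.
Context {S : ptopologicalType} {d : nat}.
Variables (Z Z' : Omega -> borel S) (Psi : borel S -> 'M[R[i]]_d) (alpha : R)
  (D : Omega -> 'M[R[i]]_d).

Lemma mgf_le_stein_pair :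
  (0 < d)%N -> exchangeable_pair P Z Z' ->
  (forall z, Psi z \is hermsymmx) -> mx_bmf Psi -> 0 < alpha ->
  (forall w, D w \is hermsymmx) -> mx_bmf D ->
  same_condexp P Z (fun w => Psi (Z w) - Psi (Z' w))
    (fun w => alpha%:C *: Psi (Z w)) ->
  same_condexp P Z (fun w => (Psi (Z w) - Psi (Z' w)) ^+ 2)
    (fun w => (2 * alpha)%:C *: D w) ->
  forall psi : R, 0 < psi ->
  let r := psi^-1 * ln (Ex P (fun w => ntr (mexp (psi%:C *: D w)))) in
  0 <= r /\ forall s : R, 0 < s < Num.sqrt psi ->
    Ex P (fun w => ntr (mexp (s%:C *: Psi (Z w)))) <=
    expR (r * s ^+ 2 / (2 * (1 - s / Num.sqrt psi))).
Proof.
move=> d0 ZZ' hPsi bPsi a0 hD bD stein1 stein2.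
have [mZ mZ' law] := ZZ'.
pose X w := Psi (Z w); pose X' w := Psi (Z' w).
have hX w : X w \is hermsymmx by exact: hPsi.
have hX' w : X' w \is hermsymmx by exact: hPsi.
have bX : mx_bmf X by exact: (mx_bmf_comp bPsi mZ).
have bX' : mx_bmf X' by exact: (mx_bmf_comp bPsi mZ').
have bXX' := mx_bmfB bX bX'; have bsq := mx_bmfX 2 bXX'.
have bexp dT (T : measurableType dT) (F : T -> 'M[R[i]]_d) (s : R) : mx_bmf F ->
    mx_bmf (fun w => mexp (s%:C *: F w)).
  by move=> bF; exact: (mx_bmf_mexp (mx_bmfZ s bF)).
have swap (G : borel S * borel S -> R) : bmf G ->
    Ex P (fun w => G (Z w, Z' w)) = Ex P (fun w => G (Z' w, Z w)).
  move=> bG; apply: (Ex_eq_law (phi := fun w => (Z w, Z' w))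
    (psi := fun w => (Z' w, Z w))) law bG; exact: measurable_fun_pair.
have b1 : mx_bmf (fun p : borel S * borel S => Psi p.1).
  exact: (mx_bmf_comp bPsi measurable_fst).
have b2 : mx_bmf (fun p : borel S * borel S => Psi p.2).
  exact: (mx_bmf_comp bPsi measurable_snd).
have b12 := mx_bmfB b1 b2.
pose e (s : R) w := ntr (mexp (s%:C *: X w)).
pose x (s : R) w := ntr (X w *m mexp (s%:C *: X w)).
pose v (s : R) w := ntr (D w *m mexp (s%:C *: X w)).
pose eD (s : R) w := ntr (mexp (s%:C *: D w)).
pose a (s : R) w := ntr ((X w - X' w) *m mexp (s%:C *: X w)).
pose a' (s : R) w := ntr ((X w - X' w) *m mexp (s%:C *: X' w)).
pose q (s : R) w := ntr ((X w - X' w) ^+ 2 *m mexp (s%:C *: X w)).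
pose q' (s : R) w := ntr ((X w - X' w) ^+ 2 *m mexp (s%:C *: X' w)).
have be s : bmf (e s) by exact: (bmf_ntr (bexp _ _ X s bX)).
have bx s : bmf (x s) by exact: (bmf_ntr (mx_bmfM bX (bexp _ _ X s bX))).
have bv s : bmf (v s) by exact: (bmf_ntr (mx_bmfM bD (bexp _ _ X s bX))).
have beD s : bmf (eD s) by exact: (bmf_ntr (bexp _ _ D s bD)).
have ba s : bmf (a s) by exact: (bmf_ntr (mx_bmfM bXX' (bexp _ _ X s bX))).
have ba' s : bmf (a' s) by exact: (bmf_ntr (mx_bmfM bXX' (bexp _ _ X' s bX'))).
have bq s : bmf (q s) by exact: (bmf_ntr (mx_bmfM bsq (bexp _ _ X s bX))).
have bq' s : bmf (q' s) by exact: (bmf_ntr (mx_bmfM bsq (bexp _ _ X' s bX'))).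
have mv s w : 0 <= s -> a s w - a' s w <= s / 2 * (q s w + q' s w).
  move=> s0; have := ntr_mexp_mean_value s0 (hX w) (hX' w); rewrite /a /a' /q /q'.
  move: (mexp (s%:C *: X w)) (mexp (s%:C *: X' w)) => U V.
  by rewrite (mulmxBr (X w - X' w) U V) ntrB (mulmxDr ((X w - X' w) ^+ 2) U V) ntrD.
have yg psi s c l w : expR (- l) * (psi * v s w + (l - c + 1) * e s w - s * x s w) <=
    expR (- c) * eD psi w.
  exact: (ntr_young psi s c l (hX w) (hD w)).
have x0 w : x 0 w = ntr (X w) by rewrite /x (mexp0 (hX w)) (mulmx1 (X w)).
have v0 w : v 0 w = ntr (D w) by rewrite /v (mexp0 (hX w)) (mulmx1 (D w)).
have q0 w : q 0 w = ntr ((X w - X' w) ^+ 2).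
  by rewrite /q (mexp0 (hX w)) (mulmx1 ((X w - X' w) ^+ 2)).
have ge s w : 1 + s * x 0 w <= e s w by rewrite x0;
  exact: (ntr_mexp_ge1 s d0 (hX w)).
have geD s w : 1 + s * v 0 w <= eD s w by rewrite v0;
  exact: (ntr_mexp_ge1 s d0 (hD w)).
have q00 w : 0 <= q 0 w by rewrite q0;
  exact: (ntr_sqr_ge0 (hermsymmxB (hX w) (hX' w))).
have e0 w : e 0 w = 1 by rewrite /e (mexp0 (hX w)) (ntr1 d0).
have aa' w : a 0 w = a' 0 w by rewrite /a /a' (mexp0 (hX w)) (mexp0 (hX' w)).
have de (t : R) w : is_derive t (1 : R) (e ^~ w) (x t w).
  exact: (is_derive_ntr_mexp t (hX w)).
have xb b : exists C, forall t w, `|t| <= b -> `|x t w| <= C.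
  have [K XK] := mx_bmf_mxl1 bX.
  by eexists => t w tb; exact: (ntr_mul_mexp_bound (hX w) (XK w) tb).
have st s : Ex P (a s) = alpha * Ex P (x s).
  rewrite -(ExZ P alpha (bx s)).
  transitivity (Ex P (fun w => ntr ((alpha%:C *: X w) *m mexp (s%:C *: X w)))).
    exact: (Ex_ntr_pull_out mZ bXX' (mx_bmfZ alpha bX) (bexp _ _ Psi s bPsi) stein1).
  by congr (Ex P _); apply/funext => w; rewrite -scalemxAl ntrZ.
have var s : Ex P (q s) = 2 * alpha * Ex P (v s).
  rewrite -(ExZ P (2 * alpha) (bv s)).
  transitivity (Ex P (fun w => ntr (((2 * alpha)%:C *: D w) *m mexp (s%:C *: X w)))).
    exact: (Ex_ntr_pull_out mZ bsq (mx_bmfZ (2 * alpha) bD) (bexp _ _ Psi s bPsi) stein2).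
  by congr (Ex P _); apply/funext => w; rewrite -scalemxAl ntrZ.
(* The swap negates X - X' and preserves its square, whence a sign here and none in [sw2]. *)
have sw1 s : Ex P (a s) = - Ex P (a' s).
  rewrite -(ExN P (ba' s)).
  transitivity (Ex P (fun w => ntr ((X' w - X w) *m mexp (s%:C *: X' w)))).
    exact: (swap _ (bmf_ntr (mx_bmfM b12 (bexp _ _ _ s b1)))).
  congr (Ex P _); apply/funext => w; rewrite /a'.
  by rewrite -[X' w - X w]opprB (mulNmx (X w - X' w)) ntrN.
have sw2 s : Ex P (q s) = Ex P (q' s).
  transitivity (Ex P (fun w => ntr ((X' w - X w) ^+ 2 *m mexp (s%:C *: X' w)))).
    exact: (swap _ (bmf_ntr (mx_bmfM (mx_bmfX 2 b12) (bexp _ _ _ s b1)))).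
  congr (Ex P _); apply/funext => w; rewrite /q'.
  have -> // : (X' w - X w) ^+ 2 = (X w - X' w) ^+ 2.
  by rewrite -[X' w - X w]opprB 2!expr2 mulrNN.
move=> psi psi0; split.
- exact: (ln_Ex_eD_ge0 bv beD a0 geD q00 var psi0).
- move=> s s0.
  exact: (mgf_le be bx bv beD ba ba' bq bq' a0 mv yg ge geD q00 e0 aa' de xb st var sw1 sw2 psi0 s0).
Qed.

End bounded_stein_pair.

(** * Optimization of the Laplace parameter *)

Section optimization.
Context {R : realType}.
Implicit Types (r q t s p L e dd : R).

(* The choice s = t / (r + t / q) is optimal; it reaches q when r = 0. *)
Lemma laplace_tail r q t p dd : 0 <= r -> 0 < q -> 0 <= t -> 1 <= dd -> p <= 1 ->
  (forall s, 0 < s < q ->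
    p <= dd * expR (- s * t) * expR (r * s ^+ 2 / (2 * (1 - s / q)))) ->
  p <= dd * expR (- t ^+ 2 / (2 * r + 2 * t / q)).
Proof.
move=> r0 q0 t0 d1 p1 H.
have d0 : 0 < dd by exact: lt_le_trans d1.
have [t_eq0|t_neq0] := eqVneq t 0.
  by rewrite t_eq0 expr0n/= oppr0 mul0r expR0 mulr1 (le_trans p1).
have {t0 t_neq0}t0 : 0 < t by rewrite lt_neqAle eq_sym t_neq0.
have [r_eq0|r_neq0] := eqVneq r 0.
  (* The optimal parameter q is excluded, but for r = 0 the claimed exponent is only - q t / 2,
     which the midpoint attains. *)
  have q2 : 0 < q / 2 < q by rewrite divr_gt0//= ltr_pdivrMr// ltr_pMr// ltr1n.
  have := H _ q2; rewrite r_eq0 !mul0r expR0 mulr1 => /le_trans; apply.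
  rewrite ler_pM2l// ler_expR le_eqVlt; apply/orP; left; apply/eqP.
  by field; rewrite !gt_eqF.
have {r0 r_neq0}r0 : 0 < r by rewrite lt_neqAle eq_sym r_neq0.
have den0 : 0 < r + t / q by rewrite addr_gt0 ?divr_gt0.
pose s := t / (r + t / q).
have sq : 1 - s / q = r / (r + t / q).
  have rqt : 0 < r * q + t by rewrite addr_gt0 ?mulr_gt0.
  by rewrite /s; field; rewrite (gt_eqF q0) (gt_eqF rqt).
have sI : 0 < s < q.
  rewrite divr_gt0//= ltr_pdivrMr// mulrDr mulrCA divff ?gt_eqF// mulr1.
  by rewrite ltrDr mulr_gt0.
have := H _ sI; rewrite sq => /le_trans; apply.
rewrite -mulrA -expRD ler_pM2l// ler_expR.
rewrite le_eqVlt; apply/orP; left; apply/eqP.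
have -> : 2 * r + 2 * t / q = 2 * (r + t / q) by ring.
rewrite /s; move: (r + t / q) den0 => D D0; field.
by rewrite !gt_eqF.
Qed.

(* With u = 1/s - 1/q the bound to minimize is L u + r / (2 u) + L / q. *)
Lemma laplace_expectation r q L e : 0 <= r -> 0 < q -> 0 <= L ->
  (forall s, 0 < s < q ->
    s * e <= L + r * s ^+ 2 / (2 * (1 - s / q))) ->
  e <= Num.sqrt (2 * r * L) + L / q.
Proof.
move=> r0 q0 L0 H.
have Hu u : 0 < u -> e <= L * u + r / (2 * u) + L / q.
  move=> u0; pose s := (u + q^-1)^-1.
  have uq : 0 < u + q^-1 by rewrite addr_gt0 ?invr_gt0.
  have s0 : 0 < s by rewrite invr_gt0.
  have sq : s < q by rewrite -[ltRHS]invrK ltf_pV2 ?posrE ?invr_gt0// ltrDr.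
  have := H s; rewrite s0 sq => /(_ isT).
  have su : u = s^-1 - q^-1 by rewrite invrK addrK.
  have sq1 : 1 - s / q = s * u by rewrite su mulrBr divff// gt_eqF.
  rewrite sq1 -ler_pdivlMl// => /le_trans; apply.
  rewrite le_eqVlt; apply/orP; left; apply/eqP.
  have -> : L * u + r / (2 * u) + L / q = L * s^-1 + r / (2 * u).
    by rewrite su; ring.
  by field; rewrite !gt_eqF.
have [L_eq0|L_neq0] := eqVneq L 0.
  rewrite L_eq0 mulr0 sqrtr0 mul0r addr0; apply/ler_addgt0Pl => z z0.
  (* For L = 0 the infimum is approached as u grows; this [u] makes r / (2 u) at most [z], and r + 1
     keeps it positive when r = 0. *)
  have u0 : 0 < (r + 1) / (2 * z) by apply: divr_gt0;
    [exact: ltr_wpDl|exact: mulr_gt0].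
  have := Hu _ u0; rewrite L_eq0 !mul0r add0r !addr0 => /le_trans; apply.
  rewrite ler_pdivrMr; last by rewrite mulr_gt0.
  have -> : z * (2 * ((r + 1) / (2 * z))) = r + 1 by field; rewrite gt_eqF.
  by rewrite lerDl.
have {L0 L_neq0}L0 : 0 < L by rewrite lt_neqAle eq_sym L_neq0.
have [r_eq0|r_neq0] := eqVneq r 0.
  rewrite r_eq0 mulr0 mul0r sqrtr0 add0r; apply/ler_addgt0Pl => z z0.
  (* For r = 0 the infimum is approached as u tends to 0; here L u = z. *)
  have u0 : 0 < z / L by rewrite divr_gt0.
  have := Hu _ u0; rewrite r_eq0 !mul0r addr0 => /le_trans; apply.
  by rewrite mulrCA divff ?gt_eqF// mulr1.
have {r0 r_neq0}r0 : 0 < r by rewrite lt_neqAle eq_sym r_neq0.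
have w0 : 0 < Num.sqrt (2 * r * L) by rewrite sqrtr_gt0 !mulr_gt0.
have w2 : Num.sqrt (2 * r * L) ^+ 2 = 2 * r * L.
  by rewrite sqr_sqrtr// ltW// !mulr_gt0.
move: (Num.sqrt _) w0 w2 => w w0 w2.
(* The minimizer sqrt (r / (2 L)) of L u + r / (2 u), written with w = sqrt (2 r L). *)
have u0 : 0 < w / (2 * L) by rewrite divr_gt0 ?mulr_gt0.
have := Hu _ u0 => /le_trans; apply; rewrite lerD2r.
rewrite le_eqVlt; apply/orP; left; apply/eqP.
have -> : r = w ^+ 2 / (2 * L) by rewrite w2; field; rewrite gt_eqF.
by field; rewrite !gt_eqF.
Qed.

End optimization.

(** * Truncation and measurability *)

Section entrywise.
Context {R : realType} {d : nat}.
Implicit Types A : 'M[R[i]]_d.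

Lemma hermsymmx_ReIm A : A \is hermsymmx <-> forall i j,
  complex.Re (A i j) = complex.Re (A j i) /\
  complex.Im (A i j) = - complex.Im (A j i).
Proof.
split=> [/is_hermitianmxP + i j|hA].
  rewrite expr0 scale1r => /matrixP/(_ i j); rewrite !mxE => ->.
  by case: (A j i).
apply/is_hermitianmxP; rewrite expr0 scale1r; apply/matrixP => i j; rewrite !mxE.
have [] := hA i j; case: (A i j) => a b; case: (A j i) => a' b' /= -> ->.
by [].
Qed.

Lemma Re_le_mxl1 A i j : `|complex.Re (A i j)| <= mxl1 A.
Proof. by rewrite -lecR (le_trans (normc_ge_Re _))// -[A]expr1 normc_mxX. Qed.

Lemma Im_le_mxl1 A i j : `|complex.Im (A i j)| <= mxl1 A.
Proof. by rewrite -lecR (le_trans (normc_ge_Im _))// -[A]expr1 normc_mxX. Qed.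

Lemma mxl1_eq0 A : mxl1 A = 0 -> A = 0.
Proof.
move=> A0; apply/matrixP => i j; rewrite mxE.
have := Re_le_mxl1 A i j; have := Im_le_mxl1 A i j; rewrite A0 !normr_le0.
by case: (A i j) => a b /= /eqP -> /eqP ->.
Qed.

Lemma mxl1_0 : mxl1 (0 : 'M[R[i]]_d) = 0.
Proof.
by rewrite /mxl1 big1// => i _; rewrite big1// => j _; rewrite mxE /= normr0 addr0.
Qed.

(** Truncating entries rather than eigenvalues makes measurability immediate; it still fixes every
    matrix with small entries. *)
Definition mxclamp (K : R) A : 'M[R[i]]_d := \matrix_(i, j)
  (clamp K (complex.Re (A i j)) +i* clamp K (complex.Im (A i j))).

Lemma mxclamp_herm K A : 0 <= K -> A \is hermsymmx -> mxclamp K A \is hermsymmx.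
Proof.
move=> K0 /hermsymmx_ReIm hA; apply/hermsymmx_ReIm => i j; rewrite !mxE /=.
by have [-> ->] := hA i j; rewrite clampN.
Qed.

Lemma mxclamp_id K A :
  (forall i j, `|complex.Re (A i j)| <= K /\ `|complex.Im (A i j)| <= K) ->
  mxclamp K A = A.
Proof.
move=> AK; apply/matrixP => i j; rewrite mxE; have [? ?] := AK i j.
by rewrite !clamp_id//; case: (A i j).
Qed.

(** The average of [A] and its adjoint. *)
Definition hermpart A : 'M[R[i]]_d := \matrix_(i, j)
  ((complex.Re (A i j) + complex.Re (A j i)) / 2 +i*
   ((complex.Im (A i j) - complex.Im (A j i)) / 2)).

Lemma hermpart_herm A : hermpart A \is hermsymmx.
Proof.
apply/hermsymmx_ReIm => i j; rewrite !mxE /=; split; first by rewrite addrC.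
by rewrite -mulNr opprB.
Qed.

Lemma hermpart_id A : A \is hermsymmx -> hermpart A = A.
Proof.
move=> /hermsymmx_ReIm hA; apply/matrixP => i j; rewrite mxE.
have [eR eI] := hA j i; rewrite eR eI opprK !mulrDl -!splitr.
by case: (A i j).
Qed.

Lemma l2norm_ge_Re (x : 'cV[R[i]]_d) k : `|complex.Re (x k 0)| <= l2norm x.
Proof.
rewrite /l2norm -sqrtr_sqr ler_wsqrtr// (bigD1 k)//= -addrA lerDl.
by rewrite addr_ge0 ?sqr_ge0// sumr_ge0// => l _; rewrite addr_ge0 ?sqr_ge0.
Qed.

Lemma l2norm_ge_Im (x : 'cV[R[i]]_d) k : `|complex.Im (x k 0)| <= l2norm x.
Proof.
rewrite /l2norm -sqrtr_sqr ler_wsqrtr// (bigD1 k)//= addrAC lerDr.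
by rewrite addr_ge0 ?sqr_ge0// sumr_ge0// => l _; rewrite addr_ge0 ?sqr_ge0.
Qed.

Lemma l2norm_le (x : 'cV[R[i]]_d) (M : R) :
  (forall k, `|complex.Re (x k 0)| <= M /\ `|complex.Im (x k 0)| <= M) ->
  l2norm x <= Num.sqrt (\sum_(k < d) (M ^+ 2 + M ^+ 2)).
Proof.
move=> xM; rewrite /l2norm ler_wsqrtr// ler_sum// => k _.
by have [xR xI] := xM k; rewrite lerD// -[leLHS]real_normK ?num_real//
  ler_pXn2r ?nnegrE// (le_trans _ xR).
Qed.

(** Boundedness makes the supremum in [spectral_norm] genuine, so that it dominates the norm of each
    column, the image of a basis vector. *)
Lemma spectral_norm_ubound A :
  has_ubound [set l2norm (A *m x) | x in [set x | l2norm x <= 1]].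
Proof.
pose M : R := \sum_(k < d) 2 * mxl1 A.
exists (Num.sqrt (\sum_(k < d) (M ^+ 2 + M ^+ 2))) => _ [x /= x1 <-].
apply: l2norm_le => i.
have ubR k : `|complex.Re (x k 0)| <= 1 by rewrite (le_trans (l2norm_ge_Re _ _)).
have ubI k : `|complex.Im (x k 0)| <= 1 by rewrite (le_trans (l2norm_ge_Im _ _)).
have pr (a b : R) : `|a| <= mxl1 A -> `|b| <= 1 -> `|a * b| <= mxl1 A.
  by move=> aA b1; rewrite normrM -[leRHS]mulr1 ler_pM.
split.
- rewrite mxE Re_sum (le_trans (ler_norm_sum _ _ _))// ler_sum// => k _.
  rewrite Re_mul (le_trans (ler_normB _ _))// mulr_natl mulr2n lerD// pr//.
  + exact: Re_le_mxl1.
  + exact: Im_le_mxl1.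
- rewrite mxE Im_sum (le_trans (ler_norm_sum _ _ _))// ler_sum// => k _.
  rewrite Im_mul (le_trans (ler_normD _ _))// mulr_natl mulr2n lerD// pr//.
  + exact: Re_le_mxl1.
  + exact: Im_le_mxl1.
Qed.

Lemma entry_le_spectral_norm A i j :
  `|complex.Re (A i j)| <= spectral_norm A /\
  `|complex.Im (A i j)| <= spectral_norm A.
Proof.
have : l2norm (col j A) <= spectral_norm A.
  rewrite colE; apply: sup_ubound; first exact: spectral_norm_ubound.
  exists (delta_mx j 0) => //=.
  rewrite /l2norm (bigD1 j)//= big1 => [|k kj].
    by rewrite !mxE !eqxx/= expr1n expr0n/= !addr0 sqrtr1.
  by rewrite !mxE (negbTE kj) /= expr0n/= addr0.
have := l2norm_ge_Re (col j A) i; have := l2norm_ge_Im (col j A) i; rewrite !mxE.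
by move=> h1 h2 h; split; [exact: le_trans h2 h|exact: le_trans h1 h].
Qed.

End entrywise.

Section measurable_entrywise.
Context {R : realType} {dT : measure_display} {T : measurableType dT} {d : nat}.
Implicit Types F : T -> 'M[R[i]]_d.

Lemma mx_bmf_clamp K F : 0 <= K -> mx_mfun F -> mx_bmf (fun w => mxclamp K (F w)).
Proof.
move=> K0 mF i j; have [mR mI] := mF i j; split.
- by under eq_fun do rewrite mxE /=; exact: bmf_clamp.
- by under eq_fun do rewrite mxE /=; exact: bmf_clamp.
Qed.

Lemma mx_mfun_hermpart F : mx_mfun F -> mx_mfun (fun w => hermpart (F w)).
Proof.
move=> mF i j; have [mR mI] := mF i j; have [mR' mI'] := mF j i; split.
- under eq_fun do rewrite mxE /=.
  by apply: measurable_funM => //; exact: measurable_funD.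
- under eq_fun do rewrite mxE /=.
  by apply: measurable_funM => //; exact: measurable_funB.
Qed.

Lemma measurable_mxl1 F : mx_mfun F -> measurable_fun setT (fun w => mxl1 (F w)).
Proof.
move=> mF; apply: measurable_sum => i; apply: measurable_sum => j.
have [mR mI] := mF i j.
by apply: measurable_funD; exact: measurableT_comp.
Qed.

(* lambda_max is the limit of ln (tr e^{nA}) / n. *)
Lemma measurable_lambda_max F : (0 < d)%N -> (forall w, F w \is hermsymmx) ->
  mx_mfun F -> measurable_fun setT (fun w => lambda_max (F w)).
Proof.
move=> d0 hF mF.
have mexpF (n : nat) : measurable_fun setT
    (fun w => n.+1%:R^-1 * ln (d%:R * ntr (mexp (n.+1%:R%:C *: F w)))).
  apply: measurable_funM => //.
  apply: (measurableT_comp (@measurable_ln R)).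
  apply: measurable_funM => //.
  apply: mfun_ntr; apply: mx_mfun_mexp.
  by apply: mx_classZ => // f g; exact: measurable_funM.
apply: (measurable_fun_cvg mexpF) => w _.
have dd : 0 < d%:R :> R by rewrite ltr0n.
(* tr e^{sA} lies between e^{s lambda_max} and d e^{s lambda_max}, so the error of the approximation
   is at most ln d / s. *)
have lo n : lambda_max (F w) <=
  n.+1%:R^-1 * ln (d%:R * ntr (mexp (n.+1%:R%:C *: F w))).
  have := expR_lambda_max_le n.+1%:R d0 (hF w) => h.
  rewrite ler_pdivlMl ?ltr0n// -ler_expR lnK// posrE.
  exact: lt_le_trans (expR_gt0 _) h.
have hi n : n.+1%:R^-1 * ln (d%:R * ntr (mexp (n.+1%:R%:C *: F w))) <=
    lambda_max (F w) + ln d%:R * n.+1%:R^-1.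
  have h := expR_lambda_max_le n.+1%:R d0 (hF w).
  have h2 := ntr_mexp_le_lambda_max d0 (ler0n R n.+1) (hF w).
  rewrite ler_pdivrMl ?ltr0n// mulrDr mulrCA divff ?pnatr_eq0// mulr1.
  rewrite -ler_expR lnK ?posrE; last exact: lt_le_trans (expR_gt0 _) h.
  by rewrite expRD lnK ?posrE// mulrC ler_pM2r.
apply: (@squeeze_cvgr _ _ _ _ (fun=> lambda_max (F w))
  (fun n => lambda_max (F w) + ln d%:R * n.+1%:R^-1)).
- by near=> n; rewrite lo hi.
- exact: cvg_cst.
- rewrite -[X in _ --> X]addr0 -(mulr0 (ln d%:R)); apply: cvgD;
  first exact: cvg_cst.
  by apply: cvgMr; exact: cvg_harmonic.
Unshelve. all: by end_near. Qed.

Lemma bmf_lambda_max F : (0 < d)%N -> (forall w, F w \is hermsymmx) ->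
  mx_bmf F -> bmf (fun w => lambda_max (F w)).
Proof.
move=> d0 hF bF; split; first exact: measurable_lambda_max (mx_bmf_mfun bF).
have [K FK] := mx_bmf_mxl1 bF; exists (d%:R * K) => w.
have [i ->] := lambda_max_eigval d0 (hF w).
by rewrite (le_trans (eigval_le_mxl1 _ _))// ler_wpM2l.
Qed.

End measurable_entrywise.

Section condexp_lemmas.
Context {R : realType} {dO : measure_display} {Omega : measurableType dO}.
Variable P : probability Omega R.
Context {S : ptopologicalType}.
Variable Z : Omega -> borel S.
Hypothesis mZ : measurable_fun setT Z.

Lemma is_condexp_cst (r : R) : is_condexp P Z (fun=> r) (fun=> r).
Proof.
have ir : P.-integrable setT (EFin \o (fun=> r)).
  by apply: bmf_integrable; exact: bmf_cst.
by split.
Qed.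

Lemma is_condexpN f g : is_condexp P Z f g ->
  is_condexp P Z (fun w => - f w) (fun w => - g w).
Proof.
move=> [fi mg gi fg].
have iN h : P.-integrable setT (EFin \o h) ->
  P.-integrable setT (EFin \o (fun w => - h w)).
  move=> ih; apply: (eq_integrable measurableT (-%E \o (EFin \o h))%E) => //.
  exact: integrableN.
split; [exact: iN| |exact: iN|].
- exact: measurableT_comp mg.
- move=> B mB; have mZB : measurable (Z @^-1` B).
    by rewrite -[X in measurable X]setTI; exact: mZ.
  have eN h : P.-integrable setT (EFin \o h) ->
      (\int[P]_(w in Z @^-1` B) (- h w)%:E = - \int[P]_(w in Z @^-1` B) (h w)%:E)%E.
    move=> ih; rewrite -integralN; first by apply: eq_integral.
    apply: integrable_add_def => //; exact: integrableS ih.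
  by rewrite !eN// fg.
Qed.

Lemma condexp_eq f g1 g2 : is_condexp P Z f g1 -> is_condexp P Z f g2 ->
  {ae P, forall w, g1 w = g2 w}.
Proof.
move=> h1 h2.
have ff : {ae P, forall w, f w <= f w} by apply: aeW => w.
apply: filterS2 (condexp_le mZ h1 h2 ff) (condexp_le mZ h2 h1 ff) => w a b.
by apply/eqP; rewrite eq_le a.
Qed.

Lemma condexp_bound f g (K : R) : is_condexp P Z f g ->
  {ae P, forall w, `|f w| <= K} -> {ae P, forall w, `|g w| <= K}.
Proof.
move=> fg fK.
have h1 : {ae P, forall w, f w <= K}.
  by apply: filterS fK => w; exact: le_trans (ler_norm _).
have h2 : {ae P, forall w, - K <= f w}.
  by apply: filterS fK => w; rewrite ler_norml => /andP[].
apply: filterS2 (condexp_le mZ fg (is_condexp_cst K) h1)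
  (condexp_le mZ (is_condexp_cst (- K)) fg h2) => w a b.
by rewrite ler_norml a b.
Qed.

End condexp_lemmas.

Lemma hermsymmx_sqr {C : numClosedFieldType} n (A : 'M[C]_n) :
  A \is hermsymmx -> A ^+ 2 \is hermsymmx.
Proof.
move=> /is_hermitianmxP; rewrite expr0 scale1r => eA.
apply/is_hermitianmxP; rewrite expr0 scale1r expr2 -[A * A]/(A *m A).
by rewrite trmx_mul map_mxM -eA.
Qed.

Lemma hermsymmxZ {R : realType} n (r : R) (A : 'M[R[i]]_n) :
  A \is hermsymmx -> r%:C *: A \is hermsymmx.
Proof.
move=> /hermsymmx_ReIm hA; apply/hermsymmx_ReIm => i j; have [eR eI] := hA i j.
by rewrite !mxE !Re_scale !Im_scale eR eI mulrN.
Qed.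

Lemma ae_eq_measure {R : realType} (dO : measure_display) (Omega : measurableType dO)
    (P : probability Omega R) (A B : set Omega) :
  measurable A -> measurable B -> {ae P, forall w, A w = B w} -> P A = P B.
Proof.
move=> mA mB AB; rewrite -[A]setIT -[B]setIT -!integral_indic//.
apply: ae_eq_integral => //.
- by apply/measurable_EFinP; exact: measurable_indic.
- by apply/measurable_EFinP; exact: measurable_indic.
- apply: filterS AB => w ABw _; congr (_%:E); rewrite !indicE; congr (_%:R).
  by congr nat_of_bool; apply/idP/idP; rewrite !inE ABw.
Qed.

Section truncation.
Context {R : realType} {dO : measure_display} {Omega : measurableType dO}.
Variable P : probability Omega R.
Context {S : ptopologicalType} {d : nat}.
Variables (Z Z' : Omega -> borel S) (Psi : borel S -> 'M[R[i]]_d).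
Implicit Types F G : Omega -> 'M[R[i]]_d.

Lemma ae_spectral_norm_clamp (X : Omega -> 'M[R[i]]_d) (K : R) :
  {ae P, forall w, spectral_norm (X w) <= K} ->
  {ae P, forall w, mxclamp K (X w) = X w}.
Proof.
apply: filterS => w XK; apply: mxclamp_id => i j.
have [h1 h2] := entry_le_spectral_norm (X w) i j.
by split; [exact: le_trans h1 XK|exact: le_trans h2 XK].
Qed.

(** The almost sure bound is given for [X] alone. That clamping changes Psi(z) is a measurable
    condition on z, and [Z] and [Z'] have the same law, so [X'] inherits the bound. *)
Lemma ae_mxclamp_exchange (K : R) : 0 <= K -> exchangeable_pair P Z Z' ->
  mx_mfun Psi -> {ae P, forall w, mxclamp K (Psi (Z w)) = Psi (Z w)} ->
  {ae P, forall w, mxclamp K (Psi (Z' w)) = Psi (Z' w)}.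
Proof.
move=> K0 [mZ mZ' law] mPsi ZK.
pose f z := mxl1 (Psi z - mxclamp K (Psi z)).
have mf : measurable_fun setT f.
  apply: measurable_mxl1.
  have mcst (r : R) : measurable_fun [set: borel S] (fun=> r) by [].
  apply: (mx_classB mcst (@measurable_funD _ _ _ _) (@measurable_funM _ _ _ _)) => //.
  exact: mx_bmf_mfun (mx_bmf_clamp K0 mPsi).
pose B := [set z | f z != 0].
have mB : measurable B.
  rewrite (_ : B = f @^-1` (~` [set 0])).
    by rewrite -[X in measurable X]setTI; apply: mf => //; exact: measurableC.
  by apply/seteqP; split => z /eqP.
have ZB : P (Z @^-1` B) = 0.
  have mZB : measurable (Z @^-1` B) by rewrite -[X in measurable X]setTI; exact: mZ.
  have [N [mN N0 subN]] := ZK; apply: (subset_measure0 _ _ _ N0) => //.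
  apply: subset_trans subN => w /= Bw ZKw; move: Bw.
  by rewrite /B/= /f ZKw subrr; apply/negP; rewrite negbK; exact/eqP/mxl1_0.
have mZ'B : measurable (Z' @^-1` B) by rewrite -[X in measurable X]setTI;
  exact: mZ'.
exists (Z' @^-1` B); split => //.
(* Rectangles with full second side extract the equality of the marginal laws. *)
- have := law (B `*` setT) (measurableX mB measurableT).
  rewrite /pushforward.
  have -> : (fun w => (Z w, Z' w)) @^-1` (B `*` setT) = Z @^-1` B.
    by apply/seteqP; split => w // [].
  have -> : (fun w => (Z' w, Z w)) @^-1` (B `*` setT) = Z' @^-1` B.
    by apply/seteqP; split => w // [].
  by rewrite ZB => <-.
- move=> w /= h; apply/negP => /eqP fw; apply: h.
  by have /eqP := mxl1_eq0 fw; rewrite subr_eq0 => /eqP <-.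
Qed.

Lemma mx_condexp_same F G F' G' : measurable_fun setT Z -> is_mx_condexp P Z F G ->
  mx_bmf F' -> mx_bmf G' ->
  {ae P, forall w, F w = F' w} -> {ae P, forall w, G w = G' w} ->
  @same_condexp R dO Omega P S d Z F' G'.
Proof.
move=> mZ FG bF bG FF GG h i j bh.
have [[bF1 bF2] [bG1 bG2]] := (bF i j, bG i j).
have [cR cI] := FG i j; split.
- apply: (Ex_pull_out mZ cR bF1 bG1) bh.
  + by apply: filterS FF => w ->.
  + by apply: filterS GG => w ->.
- apply: (Ex_pull_out mZ cI bF2 bG2) bh.
  + by apply: filterS FF => w ->.
  + by apply: filterS GG => w ->.
Qed.

(** Hermitian symmetry is a family of finitely many linear relations between entries, each inherited
    almost surely by uniqueness of conditional expectations. *)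
Lemma mx_condexp_herm F G : measurable_fun setT Z -> is_mx_condexp P Z F G ->
  (forall w, F w \is hermsymmx) -> {ae P, forall w, G w \is hermsymmx}.
Proof.
move=> mZ FG hF.
have h (i j : 'I_d) : {ae P, forall w,
    complex.Re (G w i j) = complex.Re (G w j i) /\
    complex.Im (G w i j) = - complex.Im (G w j i)}.
  have [[cR cI] [cR' cI']] := (FG i j, FG j i).
  have eR : (fun w => complex.Re (F w i j)) = (fun w => complex.Re (F w j i)).
    by apply/funext => w; have /hermsymmx_ReIm/(_ i j)[] := hF w.
  have eI : (fun w => complex.Im (F w i j)) = (fun w => - complex.Im (F w j i)).
    by apply/funext => w; have /hermsymmx_ReIm/(_ i j)[] := hF w.
  rewrite eR in cR; rewrite eI in cI.
  have e1 := condexp_eq mZ cR cR'.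
  have e2 := condexp_eq mZ cI (is_condexpN mZ cI').
  exact: filterS2 e1 e2.
have : {ae P, forall w, forall i j, complex.Re (G w i j) = complex.Re (G w j i) /\
    complex.Im (G w i j) = - complex.Im (G w j i)}.
  by apply: filter_forall => i; apply: filter_forall => j; exact: h.
by apply: filterS => w hw; apply/hermsymmx_ReIm.
Qed.

Lemma mx_condexp_bound F G F' : measurable_fun setT Z -> is_mx_condexp P Z F G ->
  mx_bmf (F' : Omega -> 'M[R[i]]_d) -> {ae P, forall w, F w = F' w} ->
  exists K : R, {ae P, forall w i j, `|complex.Re (G w i j)| <= K /\
    `|complex.Im (G w i j)| <= K}.
Proof.
move=> mZ FG bF FF; have [K FK] := mx_bmf_mxl1 bF; exists K.
apply: filter_forall => i; apply: filter_forall => j.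
have [cR cI] := FG i j.
have h1 : {ae P, forall w, `|complex.Re (F w i j)| <= K}.
  by apply: filterS FF => w ->; exact: le_trans (Re_le_mxl1 _ _ _) (FK w).
have h2 : {ae P, forall w, `|complex.Im (F w i j)| <= K}.
  by apply: filterS FF => w ->; exact: le_trans (Im_le_mxl1 _ _ _) (FK w).
exact: filterS2 (condexp_bound mZ cR h1) (condexp_bound mZ cI h2).
Qed.

End truncation.

(** * From the moment generating function to tail and mean *)

Lemma EFin_Ex_indic {R : realType} (dO : measure_display) (Omega : measurableType dO)
    (P : probability Omega R) (A : set Omega) :
  measurable A -> (Ex P (fun w => \1_A w))%:E = P A.
Proof. by move=> mA; rewrite -(EFin_Ex P (bmf_indic mA)) integral_indic// setIT.
  Qed.

Lemma measurable_superlevel {R : realType} (dT : measure_display) (T : measurableType dT)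
    (f : T -> R) (t : R) : measurable_fun setT f -> measurable [set w | t <= f w].
Proof.
move=> mf; rewrite (_ : [set w | _] = f @^-1` `[t, +oo[); last first.
  by apply/seteqP; split => w /=; rewrite in_itv/= andbT.
by rewrite -[X in measurable X]setTI; apply: mf => //; exact: measurable_itv.
Qed.

Section bounds_from_mgf.
Context {R : realType} {dO : measure_display} {Omega : measurableType dO}.
Variable P : probability Omega R.
Context {d : nat}.
Variables (X : Omega -> 'M[R[i]]_d).
Hypothesis d_gt0 : (0 < d)%N.
Hypothesis hX : forall w, X w \is hermsymmx.
Hypothesis bX : mx_bmf X.

Let bE (s : R) : bmf (fun w => ntr (mexp (s%:C *: X w))).
Proof. exact: (bmf_ntr (mx_bmf_mexp (mx_bmfZ s bX))). Qed.

(** Markov's inequality in pointwise form: the indicator is at most e^{s (lambda_max - t)}, which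
    the trace exponential dominates. *)
Lemma laplace_prob (t s : R) : 0 <= s ->
  Ex P (fun w => \1_[set w | t <= lambda_max (X w)] w) <=
  d%:R * expR (- s * t) * Ex P (fun w => ntr (mexp (s%:C *: X w))).
Proof.
move=> s0; rewrite -(ExZ P _ (bE s)); apply: Ex_le => [||w].
- apply: bmf_indic; apply: measurable_superlevel.
  by have [] := bmf_lambda_max d_gt0 hX bX.
- exact: bmfZ (bE s).
- have h := expR_lambda_max_le s d_gt0 (hX w).
  rewrite indicE; case: (boolP (w \in _)); last first.
    move=> _ /=; rewrite mulrAC mulr_ge0 ?expR_ge0//.
    exact: le_trans (expR_ge0 _) h.
  rewrite inE /= => tl /=; rewrite mulrAC.
  apply: (@le_trans _ _ (expR (s * lambda_max (X w)) * expR (- s * t))).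
    rewrite -expRD mulNr -mulrBr -[leLHS]expR0 ler_expR mulr_ge0// subr_ge0//.
  by rewrite ler_wpM2r ?expR_ge0.
Qed.

(** Jensen's inequality through a tangent line: z - c + 1 <= e^{z - c} at z = s lambda_max, where c
    = ln d + b makes the expectation of the right side at most 1. *)
Lemma laplace_mean (s b : R) :
  Ex P (fun w => ntr (mexp (s%:C *: X w))) <= expR b ->
  s * Ex P (fun w => lambda_max (X w)) <= ln d%:R + b.
Proof.
move=> Eb.
have dd : 0 < d%:R :> R by rewrite ltr0n.
set c := ln d%:R + b.
have bl := bmf_lambda_max d_gt0 hX bX.
have h : Ex P (fun w => s * lambda_max (X w) + (1 - c)) <=
    Ex P (fun w => d%:R * expR (- c) * ntr (mexp (s%:C *: X w))).
  apply: (Ex_le _ (bmfD (bmfZ s bl) (bmf_cst _)) (bmfZ _ (bE s))) => w.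
  rewrite mulrAC.
  have h1 := expR_lambda_max_le s d_gt0 (hX w).
  apply: (@le_trans _ _ (expR (s * lambda_max (X w)) * expR (- c))).
    rewrite -expRD (le_trans _ (expR_ge1Dx _))//; lra.
  by rewrite ler_wpM2r ?expR_ge0.
rewrite (ExD P (bmfZ s bl) (bmf_cst _)) (ExZ P s bl) Ex_cst (ExZ P _ (bE s)) in h.
have : d%:R * expR (- c) * Ex P (fun w => ntr (mexp (s%:C *: X w))) <= 1.
  apply: (@le_trans _ _ (d%:R * expR (- c) * expR b)).
    by rewrite ler_wpM2l// mulr_ge0 ?expR_ge0.
  rewrite -mulrA -expRD /c opprD subrK expRN lnK ?posrE//.
  by rewrite divff// gt_eqF.
move: h; lra.
Qed.

End bounds_from_mgf.

Lemma r_psiE {R : realType} (dO : measure_display) (Omega : measurableType dO)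
    (P : probability Omega R) d (Delta D : Omega -> 'M[R[i]]_d) (psi : R) :
  mx_mfun Delta -> mx_bmf D -> {ae P, forall w, Delta w = D w} ->
  r_psi P Delta psi = psi^-1 * ln (Ex P (fun w => ntr (mexp (psi%:C *: D w)))).
Proof.
move=> mDelta bD aeD; have bexp := bmf_ntr (mx_bmf_mexp (mx_bmfZ psi bD)).
rewrite /r_psi -[Ex _ _]/(fine (Ex P _)%:E) -(EFin_Ex P bexp).
congr (psi^-1 * ln (fine _)).
transitivity ('E_P[fun w => ntr (mexp (psi%:C *: Delta w))])%E.
  by congr expectation; apply/funext => w; exact: Re_normalized_trace.
rewrite unlock; apply: ae_eq_integral => //.
- apply/measurable_EFinP/mfun_ntr/mx_mfun_mexp.
  by apply: mx_classZ => // f g; exact: measurable_funM.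
- exact/measurable_EFinP/(proj1 bexp).
- by apply: filterS aeD => w -> _.
Qed.

Unset Implicit Arguments.

Theorem theorem5p1 (R : realType) (disp : measure_display)
    (Omega : measurableType disp) (P : probability Omega R)
    (S : ptopologicalType) (d : nat) (Z Z' : Omega -> borel S)
    (Psi : borel S -> 'M[R[i]]_d) (alpha : R)
    (X X' Delta : Omega -> 'M[R[i]]_d)
    (d_ge1 : (1 <= d)%N)
    (S_polish : polish R S)
    (XX'_stein : matrix_stein_pair P Z Z' Psi alpha X X')
    (Delta_var : is_conditional_variance P Z alpha X X' Delta)
    (X_bounded : ae_bounded_in_norm P X) :
  (forall t psi : R, 0 <= t -> 0 < psi ->
    (P [set w | (t <= lambda_max (X w))%R] <=
      (d%:R * expR (- t ^+ 2 /
        (2 * r_psi P Delta psi + 2 * t / Num.sqrt psi)))%:E)%E) /\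
  (forall psi : R, 0 < psi ->
    ('E_P[fun w => lambda_max (X w)] <=
      (Num.sqrt (2 * r_psi P Delta psi * ln d%:R)
       + ln d%:R / Num.sqrt psi)%:E)%E).
Proof.
have [ZZ' hPsi mPsi0 eX eX' /andP[a0 _] _ [V1 cV1 V1X]] := XX'_stein.
have [V2 cV2 DeltaE] := Delta_var.
have [K0 XK0] := X_bounded.
have [mZ mZ' _] := ZZ'.
have mPsi : mx_mfun Psi by exact: mPsi0.
have mX : mx_mfun X.
  by move=> i j; rewrite eX; have [m1 m2] := mPsi i j;
    split; [exact: (measurableT_comp m1 mZ)|exact: (measurableT_comp m2 mZ)].
have hX w : X w \is hermsymmx by rewrite eX; exact: hPsi.
have hX' w : X' w \is hermsymmx by rewrite eX'; exact: hPsi.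
(* The clamping level must be nonnegative, which the given bound is not known to be. *)
pose K := Num.max K0 0.
have K_ge0 : 0 <= K by rewrite le_max lexx orbT.
have XK : {ae P, forall w, spectral_norm (X w) <= K}.
  by apply: filterS XK0 => w /le_trans; apply; rewrite le_max lexx.
have aeX : {ae P, forall w, mxclamp K (Psi (Z w)) = X w}.
  by have := ae_spectral_norm_clamp XK; rewrite eX.
have aeX' : {ae P, forall w, mxclamp K (Psi (Z' w)) = X' w}.
  rewrite eX'; apply: (ae_mxclamp_exchange K_ge0 ZZ' mPsi).
  by move: aeX; rewrite eX.
pose Psi1 z := mxclamp K (Psi z).
have hPsi1 z : Psi1 z \is hermsymmx by exact: mxclamp_herm.
have bPsi1 : mx_bmf Psi1 by exact: mx_bmf_clamp.
have bX1 : mx_bmf (fun w => Psi1 (Z w)) by exact: (mx_bmf_comp bPsi1 mZ).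
have bX1' : mx_bmf (fun w => Psi1 (Z' w)) by exact: (mx_bmf_comp bPsi1 mZ').
have bdiff := mx_bmfB bX1 bX1'; have bsq := mx_bmfX 2 bdiff.
have aediff : {ae P, forall w, X w - X' w = Psi1 (Z w) - Psi1 (Z' w)}.
  by apply: filterS2 aeX aeX' => w <- <-.
have aesq : {ae P, forall w, (X w - X' w) ^+ 2 = (Psi1 (Z w) - Psi1 (Z' w)) ^+ 2}.
  by apply: filterS aediff => w ->.
have hsq w : (X w - X' w) ^+ 2 \is hermsymmx
  by exact: (hermsymmx_sqr (hermsymmxB (hX w) (hX' w))).
have aeV2h := mx_condexp_herm mZ cV2 hsq.
have [K2 aeV2K] := mx_condexp_bound mZ cV2 bsq aesq.
(* Measurability on [Omega] is read off integrability; the other clause of [is_condexp] concerns the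
   sigma-algebra generated by [Z]. *)
have mV2 : mx_mfun V2.
  move=> i j; have [[_ _ iR _] [_ _ iI _]] := cV2 i j.
  by split; apply/measurable_EFinP;
    [exact: (measurable_int _ iR)|exact: (measurable_int _ iI)].
pose c : R := (2 * alpha)^-1.
have c0 : 0 < 2 * alpha by rewrite mulr_gt0.
have mDelta : mx_mfun Delta.
  have -> : Delta = fun w => c%:C *: V2 w by apply/funext => w; exact: DeltaE.
  by apply: mx_classZ => // f g; exact: measurable_funM.
pose K3 := Num.max K2 0.
have K3_ge0 : 0 <= K3 by rewrite le_max lexx orbT.
(* [V2] is Hermitian and bounded only almost surely; symmetrizing and then clamping makes both hold
   everywhere and changes it only on a null set. *)
pose D w := c%:C *: mxclamp K3 (hermpart (V2 w)).
have hD w : D w \is hermsymmx.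
  by apply: hermsymmxZ; apply: mxclamp_herm => //; exact: hermpart_herm.
have bD : mx_bmf D by apply: mx_bmfZ; apply: mx_bmf_clamp => //;
  exact: mx_mfun_hermpart.
have aeV2 : {ae P, forall w, V2 w = (2 * alpha)%:C *: D w}.
  apply: filterS2 aeV2h aeV2K => w hw wK.
  rewrite /D scalerA -rmorphM /c divff ?gt_eqF//
    scale1r (hermpart_id hw) mxclamp_id// => i j.
  by have [h1 h2] := wK i j; rewrite !le_max h1 h2.
have aeDelta : {ae P, forall w, Delta w = D w}.
  by apply: filterS aeV2 => w e;
    rewrite DeltaE e scalerA -rmorphM mulVf ?gt_eqF// scale1r.
have aeV1 : {ae P, forall w, V1 w = alpha%:C *: Psi1 (Z w)}.
  by apply: filterS2 V1X aeX => w -> <-.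
have st1 := mx_condexp_same mZ cV1 bdiff (mx_bmfZ alpha bX1) aediff aeV1.
have st2 := mx_condexp_same mZ cV2 bsq (mx_bmfZ (2 * alpha) bD) aesq aeV2.
have core := mgf_le_stein_pair d_ge1 ZZ' hPsi1 bPsi1 a0 hD bD st1 st2.
have rE psi : r_psi P Delta psi =
  psi^-1 * ln (Ex P (fun w => ntr (mexp (psi%:C *: D w)))).
  exact: r_psiE.
have dd : 1 <= d%:R :> R by rewrite ler1n.
have mlX := measurable_lambda_max d_ge1 hX mX.
have blX1 := bmf_lambda_max d_ge1 (fun w => hPsi1 (Z w)) bX1.
split.
- move=> t psi t0 psi0; rewrite rE.
  have [r0 mgfle] := core psi psi0.
  have mA := measurable_superlevel t mlX;
    have mA1 := measurable_superlevel t (proj1 blX1).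
  have AE : {ae P, forall w, (t <= lambda_max (X w)) =
    (t <= lambda_max (Psi1 (Z w))) :> Prop}.
    by apply: filterS aeX => w; rewrite /Psi1 /= => ->.
  rewrite (ae_eq_measure mA mA1 AE) -(EFin_Ex_indic P mA1).
  rewrite lee_fin; apply: laplace_tail => //.
  + by rewrite sqrtr_gt0.
  + by rewrite -lee_fin (EFin_Ex_indic P mA1); exact: probability_le1.
  + move=> s s0; have s0' : 0 <= s by case/andP: s0 => /ltW.
    apply: le_trans (laplace_prob P d_ge1 (fun w => hPsi1 (Z w)) bX1 t s0') _.
    by rewrite ler_wpM2l ?mulr_ge0 ?expR_ge0// mgfle.
- move=> psi psi0; rewrite rE.
  have [r0 mgfle] := core psi psi0.
  have -> : ('E_P[fun w => lambda_max (X w)] =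
    (Ex P (fun w => lambda_max (Psi1 (Z w))))%:E)%E.
    rewrite -(EFin_Ex P blX1) unlock; apply: ae_eq_integral => //.
    + exact/measurable_EFinP.
    + by apply/measurable_EFinP; case: blX1.
    + by apply: filterS aeX => w; rewrite /Psi1 /= => -> _.
  rewrite lee_fin; apply: laplace_expectation => //.
  + by rewrite sqrtr_gt0.
  + exact: ln_ge0.
  + move=> s s0.
    exact: (laplace_mean d_ge1 (fun w => hPsi1 (Z w)) bX1 (mgfle s s0)).
Qed.
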